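(* There is an algorithm which, given a permutation $\pi$ of $\{1,\dots,n\}$, outputs a maximum induced matching of the permutation graph $G(\pi)$ in $\mathcal{O}(m+n)$ time, where $m$ is the number of edges of $G(\pi)$.
   Context: For a permutation $\pi=(\pi(1),\dots,\pi(n))$ of $\{1,\dots,n\}$, $\pi^{-1}(i)$ denotes the position of $i$ in $\pi$. The permutation graph $G(\pi)=(V,E)$ has $V=\{1,\dots,n\}$ and $uv\in E$ iff $(u-v)(\pi^{-1}(u)-\pi^{-1}(v))<0$. An induced matching of a graph $G=(V,E)$ is a set $M\subseteq E$ such that for any two distinct edges $u_1v_1,u_2v_2\in M$, none of $u_1u_2,u_1v_2,v_1u_2,v_1v_2$ is in $E$ (in particular the edges are vertex-disjoint). A maximum induced matching is one of maximum cardinality. Running times are in the standard RAM model. *)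

(* Defs.v *)
From mathcomp Require Import all_boot.
Set Implicit Arguments. Unset Strict Implicit. Unset Printing Implicit Defensive.

(* A permutation pi of {1..n} is given as the sequence s = (pi(1),...,  *)
(* pi(n)), i.e. perm_eq s (iota 1 n).  pi^{-1}(u) = index u s + 1.      *)

Definition pos (s : seq nat) (u : nat) : nat := (index u s).+1.

Definition in_V (s : seq nat) (u : nat) : bool := (1 <= u) && (u <= size s).

Definition pedge (s : seq nat) (u v : nat) : bool :=
  [&& in_V s u, in_V s v &
   ((u < v) && (pos s v < pos s u)) || ((v < u) && (pos s u < pos s v))].

Definition num_edges (s : seq nat) : nat :=
  \sum_(1 <= u < (size s).+1) \sum_(1 <= v < (size s).+1) ((u < v) && pedge s u v).

(* An edge set is represented as a duplicate-free list of pairs (u,v) with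
   u < v (canonical representative of the unordered edge uv). *)
Definition induced_matching (s : seq nat) (M : seq (nat * nat)) : Prop :=
  [/\ uniq M,
      (forall e, e \in M -> e.1 < e.2 /\ pedge s e.1 e.2) &
      (forall e1 e2, e1 \in M -> e2 \in M -> e1 != e2 ->
         ~~ pedge s e1.1 e2.1 /\ ~~ pedge s e1.1 e2.2 /\
         ~~ pedge s e1.2 e2.1 /\ ~~ pedge s e1.2 e2.2)].

Definition max_induced_matching (s : seq nat) (M : seq (nat * nat)) : Prop :=
  induced_matching s M /\
  (forall M', induced_matching s M' -> size M' <= size M).

(* A unit-cost RAM (registers indexed by nat, indirect addressing).     *)

Inductive instr : Type :=
| IConst of nat & nat        (* IConst d k   : R[d] := k                 *)
| IAdd of nat & nat & nat    (* IAdd d a b   : R[d] := R[a] + R[b]       *)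
| ISub of nat & nat & nat    (* ISub d a b   : R[d] := R[a] - R[b] (trunc)*)
| ILoad of nat & nat         (* ILoad d a    : R[d] := R[R[a]]           *)
| IStore of nat & nat        (* IStore a b   : R[R[a]] := R[b]           *)
| IJmp of nat                (* IJmp l       : goto l                    *)
| IJmpZ of nat & nat         (* IJmpZ a l    : if R[a] = 0 then goto l   *)
| IHalt.

Definition program := seq instr.

Record state := State { pc : nat; regs : nat -> nat }.

Definition upd (m : nat -> nat) (a v : nat) : nat -> nat :=
  fun r => if r == a then v else m r.

Definition halted (P : program) (st : state) : bool :=
  if nth IHalt P (pc st) is IHalt then true else false.

(* one step; a halted state (pc past the end, or on IHalt) is a fixpoint *)
Definition step (P : program) (st : state) : state :=
  let m := regs st in
  let p := pc st in
  match nth IHalt P p with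
  | IConst d k => State p.+1 (upd m d k)
  | IAdd d a b => State p.+1 (upd m d (m a + m b))
  | ISub d a b => State p.+1 (upd m d (m a - m b))
  | ILoad d a => State p.+1 (upd m d (m (m a)))
  | IStore a b => State p.+1 (upd m (m a) (m b))
  | IJmp l => State l m
  | IJmpZ a l => if m a == 0 then State l m else State p.+1 m
  | IHalt => st
  end.

Definition run (P : program) (t : nat) (st : state) : state := iter t (step P) st.

(* Input encoding: R[0] = n, R[i] = pi(i) for 1 <= i <= n, all else 0. *)
Definition init (s : seq nat) : state :=
  State 0 (fun r => if r == 0 then size s else nth 0 s r.-1).

(* Output decoding: R[0] = k, the i-th edge (i < k) is {R[2i+1], R[2i+2]},
   normalised to (min, max). *)
Definition output (st : state) : seq (nat * nat) :=
  let m := regs st in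
  [seq (minn (m i.*2.+1) (m i.*2.+2), maxn (m i.*2.+1) (m i.*2.+2)) | i <- iota 0 (m 0)].

(* Main.v *)
Require Import Defs.
From mathcomp Require Import all_boot.
From mathcomp Require Import zify.

(** An edge of the permutation graph is an inversion: a value [c] standing before a
    smaller value [b]. It spans a box, the positions between those of [c] and [b]
    times the values between [b] and [c]. Two edges can lie together in an induced
    matching exactly when one box is strictly below and to the left of the other,
    so a maximum induced matching is a longest chain of boxes.

    Let F(i, y) be the longest chain in the first [i] positions and the values below
    [y]. Sweep the permutation from left to right. When [a] arrives at position [i],
    F changes only at the values above [a] already seen, and there the new value is
    the maximum of the old one, of the one at the next smaller seen value, and of
    1 + F(j, a) for the edge between [a] and the value at position [j]. The numbers
    F(i, b) which later edges will query concern the unseen values [b < a]; such a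
    [b] inherits the chain of [b - 1], which is either seen or was just treated. Both
    groups consist of neighbours of [a] and are the ends of sorted linked lists, so
    the sweep takes time O(m + n). Registers start at zero, hence the quadratic
    table of edge nodes costs nothing where it is not used.

    Time is accounted for by a weakest-precondition calculus with a step budget over
    structured programs compiled to the machine. *)

Set Implicit Arguments. Unset Strict Implicit. Unset Printing Implicit Defensive.

(** * Structured programs and their step-bounded semantics *)

Inductive cmd : Type :=
| Blk of seq instr
| Seq of cmd & cmd
| Ite of nat & cmd & cmd
| Wh of nat & cmd.

Fixpoint compile (off : nat) (c : cmd) : program :=
  match c with
  | Blk l => l
  | Seq c1 c2 =>
      let p1 := compile off c1 in p1 ++ compile (off + size p1) c2
  | Ite r c1 c2 =>
      let p1 := compile off.+1 c1 in
      let off2 := off + size p1 + 2 in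
      let p2 := compile off2 c2 in
      IJmpZ r off2 :: p1 ++ IJmp (off2 + size p2) :: p2
  | Wh r c =>
      let p := compile off.+1 c in
      IJmpZ r (off + size p + 2) :: p ++ [:: IJmp off]
  end.

Definition code_at (P : program) (off : nat) (l : seq instr) : Prop :=
  forall k, k < size l -> nth IHalt P (off + k) = nth IHalt l k.

Lemma code_at_catl P off l1 l2 : code_at P off (l1 ++ l2) -> code_at P off l1.
Proof.
move=> H k Hk; rewrite H ?nth_cat ?Hk // size_cat; exact: ltn_addr.
Qed.

Lemma code_at_catr P off l1 l2 :
  code_at P off (l1 ++ l2) -> code_at P (off + size l1) l2.
Proof.
move=> H k Hk; rewrite -addnA H ?size_cat ?ltn_add2l // nth_cat.
by rewrite ltnNge leq_addr /= addKn.
Qed.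

Lemma code_at_head P off i l : code_at P off (i :: l) -> nth IHalt P off = i.
Proof. by move/(_ 0 isT); rewrite addn0. Qed.

Lemma code_at_tail P off i l : code_at P off (i :: l) -> code_at P off.+1 l.
Proof. by move=> H k Hk; rewrite addSnnS (H k.+1). Qed.

(** The bound on the registers is carried through every intermediate time, because the theorem
    bounds them along the whole run. *)
Definition reach (P : program) (B t : nat) (st st' : state) : Prop :=
  run P t st = st' /\ forall k r, k <= t -> regs (run P k st) r <= B.

Lemma run_add P t1 t2 st : run P (t1 + t2) st = run P t2 (run P t1 st).
Proof. by rewrite /run addnC iterD. Qed.

Lemma reach_refl P B st : (forall r, regs st r <= B) -> reach P B 0 st st.
Proof. by move=> H; split => // k r; rewrite leqn0 => /eqP ->. Qed.

Lemma reach_trans P B t1 t2 st1 st2 st3 :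
  reach P B t1 st1 st2 -> reach P B t2 st2 st3 -> reach P B (t1 + t2) st1 st3.
Proof.
move=> [E1 H1] [E2 H2]; split; first by rewrite run_add E1.
move=> k r Hk; case: (leqP k t1) => [|Hlt]; first exact: H1.
have -> : k = t1 + (k - t1) by lia.
by rewrite run_add E1; apply: H2; lia.
Qed.

Lemma reach_step P B st :
  (forall r, regs st r <= B) -> (forall r, regs (step P st) r <= B) ->
  reach P B 1 st (step P st).
Proof. by move=> H1 H2; split=> // -[|[|k]] r //= _. Qed.

(* The 24 registers addressable by constants are kept as an explicit list, so
   that symbolic execution is list computation; everything above is the heap. *)
Definition cell (rho : seq nat) (h : nat -> nat) (r : nat) : nat :=
  if r < 24 then nth 0 rho r else h r.

Lemma cell_heap rho h x : 24 <= x -> cell rho h x = h x.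
Proof. by move=> H; rewrite /cell ltnNge H. Qed.

Lemma upd_eq m a v : upd m a v a = v.
Proof. by rewrite /upd eqxx. Qed.

Lemma upd_ne m a v x : x <> a -> upd m a v x = m x.
Proof. by move/eqP/negbTE; rewrite /upd => ->. Qed.

(* Weakest precondition with a time budget [T]: the postcondition receives what
   is left of it, and [B] bounds every register content along the way. *)
Definition wp (B : nat) (c : cmd) (rho : seq nat) (h : nat -> nat) (T : nat)
    (Q : seq nat -> (nat -> nat) -> nat -> Prop) : Prop :=
  forall P off m, code_at P off (compile off c) ->
    size rho = 24 -> m =1 cell rho h -> (forall r, m r <= B) ->
    exists t m' rho' h',
      [/\ t <= T,
          reach P B t (State off m) (State (off + size (compile off c)) m'),
          size rho' = 24, m' =1 cell rho' h' & Q rho' h' (T - t)].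

Lemma reach_bounded P B t st st' : reach P B t st st' -> forall r, regs st' r <= B.
Proof. by move=> [<- H] r; apply: H. Qed.

Lemma wp_seq B c1 c2 rho h T Q :
  wp B c1 rho h T (fun r' h' T' => wp B c2 r' h' T' Q) ->
  wp B (Seq c1 c2) rho h T Q.
Proof.
move=> H P off m /= Hc Hs Hm Hb.
have [t [m1 [r1 [h1 [H1 H2 H3 H4 H5]]]]] := H P off m (code_at_catl Hc) Hs Hm Hb.
have [t2 [m2 [r2 [h2 [G1 G2 G3 G4 G5]]]]] :=
  H5 P _ m1 (code_at_catr Hc) H3 H4 (reach_bounded H2).
exists (t + t2), m2, r2, h2; split => //; first by lia.
- by rewrite size_cat addnA; apply: reach_trans H2 G2.
- by rewrite subnDA.
Qed.

(** The first branch pays for the test and for the jump over the second branch; the second branch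
    pays for the test alone. *)
Lemma wp_ite B r c1 c2 rho h T Q : r < 24 -> 2 <= T ->
  (nth 0 rho r <> 0 -> wp B c1 rho h (T - 2) Q) ->
  (nth 0 rho r = 0 -> wp B c2 rho h (T - 1) Q) ->
  wp B (Ite r c1 c2) rho h T Q.
Proof.
move=> Hr HT Hnz Hz P off m /= Hc Hs Hm Hb.
have E0 := code_at_head Hc.
have Emr : m r = nth 0 rho r by rewrite Hm /cell Hr.
have := code_at_tail Hc; rewrite -[_ ++ _]/(_ ++ [:: _] ++ _) => Hc'.
have Hc1 := code_at_catl Hc'.
have Hj := code_at_head (code_at_catr Hc').
have Hc2 := code_at_catr (code_at_catr Hc').
have Estep : step P (State off m) = State (if nth 0 rho r == 0 then
    off + size (compile off.+1 c1) + 2 else off.+1) m.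
  by rewrite /step /= E0 Emr; case: ifP.
have R1 := @reach_step P B (State off m) Hb; rewrite Estep in R1.
have {}R1 := R1 Hb.
case: (eqVneq (nth 0 rho r) 0) => Er.
- rewrite Er eqxx in R1.
  have Hoff : off.+1 + size (compile off.+1 c1) + size [:: IJmp
     (off + size (compile off.+1 c1) + 2 + size (compile (off + size (compile off.+1 c1) + 2) c2))]
     = off + size (compile off.+1 c1) + 2 by rewrite /=; lia.
  rewrite Hoff in Hc2.
  have [t [m1 [r1 [h1 [H1 H2 H3 H4 H5]]]]] := Hz Er P _ m Hc2 Hs Hm Hb.
  exists (1 + t), m1, r1, h1; split=> //; first by lia.
  + have -> : off + (size (compile off.+1 c1 ++ IJmp
     (off + size (compile off.+1 c1) + 2 + size (compile (off + size (compile off.+1 c1) + 2) c2))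
     :: compile (off + size (compile off.+1 c1) + 2) c2)).+1
     = off + size (compile off.+1 c1) + 2 + size (compile (off + size (compile off.+1 c1) + 2) c2).
       by rewrite size_cat /=; lia.
    exact: reach_trans R1 H2.
  + by rewrite subnDA.
- rewrite (negbTE Er) in R1.
  have [t [m1 [r1 [h1 [H1 H2 H3 H4 H5]]]]] := Hnz (elimN eqP Er) P _ m Hc1 Hs Hm Hb.
  exists (1 + t + 1), m1, r1, h1; split=> //; first by lia.
  + have B1 := reach_bounded H2.
    have R2 := @reach_step P B (State (off.+1 + size (compile off.+1 c1)) m1) B1.
    move: R2; rewrite {1 2}/step /= Hj => /(_ B1) R2.
    have -> : off + (size (compile off.+1 c1 ++ IJmp
     (off + size (compile off.+1 c1) + 2 + size (compile (off + size (compile off.+1 c1) + 2) c2))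
     :: compile (off + size (compile off.+1 c1) + 2) c2)).+1
     = off + size (compile off.+1 c1) + 2 + size (compile (off + size (compile off.+1 c1) + 2) c2).
       by rewrite size_cat /=; lia.
    exact: reach_trans (reach_trans R1 H2) R2.
  + by have -> : T - (1 + t + 1) = T - 2 - t by lia.
Qed.

Lemma wp_wh_stop B r c rho h T (Q : seq nat -> (nat -> nat) -> nat -> Prop) :
  r < 24 -> 1 <= T -> nth 0 rho r = 0 -> Q rho h (T - 1) ->
  wp B (Wh r c) rho h T Q.
Proof.
move=> Hr HT Hz HQ P off m /= Hc Hs Hm Hb.
have E0 := code_at_head Hc.
have Emr : m r = nth 0 rho r by rewrite Hm /cell Hr.
exists 1, m, rho, h; split=> //.
have := @reach_step P B (State off m) Hb.
rewrite {1 2}/step /= E0 Emr Hz eqxx => /(_ Hb).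
by congr (reach _ _ _ _ (State _ _)); rewrite size_cat /=; lia.
Qed.

(** One unfolding of the loop, charged for the test and the jump back. No invariant is built in:
    each loop is treated by an outer induction that bounds its rounds. *)
Lemma wp_wh_go B r c rho h T Q :
  r < 24 -> 1 <= T -> nth 0 rho r <> 0 ->
  wp B c rho h (T - 1)
     (fun r' h' T' => 1 <= T' /\ wp B (Wh r c) r' h' (T' - 1) Q) ->
  wp B (Wh r c) rho h T Q.
Proof.
move=> Hr HT Hnz H P off m Hc Hs Hm Hb.
have /= Hc0 := Hc.
have E0 := code_at_head Hc0.
have Emr : m r = nth 0 rho r by rewrite Hm /cell Hr.
have Hc' := code_at_tail Hc0.
have Hc1 := code_at_catl Hc'.
have Hj := code_at_head (code_at_catr Hc').
have R1 := @reach_step P B (State off m) Hb.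
move: R1; rewrite {1 2}/step /= E0 Emr (introF eqP Hnz) => /(_ Hb) R1.
have [t [m1 [r1 [h1 [H1 H2 H3 H4 [H5 H6]]]]]] := H P _ m Hc1 Hs Hm Hb.
have B1 := reach_bounded H2.
have R2 := @reach_step P B (State (off.+1 + size (compile off.+1 c)) m1) B1.
move: R2; rewrite {1 2}/step /= Hj => /(_ B1) R2.
have [t2 [m2 [r2 [h2 [G1 G2 G3 G4 G5]]]]] := H6 P off m1 Hc H3 H4 B1.
exists (1 + t + 1 + t2), m2, r2, h2; split=> //; first by lia.
- exact: reach_trans (reach_trans (reach_trans R1 H2) R2) G2.
- by have -> : T - (1 + t + 1 + t2) = T - 1 - t - 1 - t2 by lia.
Qed.

(** Stores must hit the heap, so that [rho] changes only at constant indices; loads may read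
    anywhere through [cell]. Jumps are rejected, as blocks are straight-line code. *)
Fixpoint blk (B : nat) (l : seq instr) (rho : seq nat) (h : nat -> nat)
    (Q : seq nat -> (nat -> nat) -> Prop) : Prop :=
  if l is i :: l' then
    match i with
    | IConst d k => [/\ d < 24, k <= B & blk B l' (set_nth 0 rho d k) h Q]
    | IAdd d a b =>
        let x := nth 0 rho a + nth 0 rho b in
        [/\ d < 24, a < 24, b < 24, x <= B & blk B l' (set_nth 0 rho d x) h Q]
    | ISub d a b =>
        [/\ d < 24, a < 24, b < 24 &
            blk B l' (set_nth 0 rho d (nth 0 rho a - nth 0 rho b)) h Q]
    | ILoad d a =>
        [/\ d < 24, a < 24 &
            blk B l' (set_nth 0 rho d (cell rho h (nth 0 rho a))) h Q]
    | IStore a b =>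
        [/\ a < 24, b < 24, 24 <= nth 0 rho a &
            blk B l' rho (upd h (nth 0 rho a) (nth 0 rho b)) Q]
    | _ => False
    end
  else Q rho h.

Lemma upd_cell_low m rho h d x : size rho = 24 -> d < 24 -> m =1 cell rho h ->
  upd m d x =1 cell (set_nth 0 rho d x) h.
Proof.
move=> Hs Hd Hm r; rewrite /upd /cell nth_set_nth /= Hm.
by case: (eqVneq r d) => [->|_] //; rewrite Hd.
Qed.

Lemma upd_cell_high m rho h a x : 24 <= a -> m =1 cell rho h ->
  upd m a x =1 cell rho (upd h a x).
Proof.
move=> Ha Hm r; rewrite /upd Hm /cell.
by case: (eqVneq r a) => [->|_] //; rewrite ltnNge Ha.
Qed.

Lemma upd_bounded B m a x : (forall r, m r <= B) -> x <= B ->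
  forall r, upd m a x r <= B.
Proof. by move=> Hm Hx r; rewrite /upd; case: ifP. Qed.

Lemma blk_correct B l : forall rho h Q P off m, blk B l rho h Q ->
  code_at P off l -> size rho = 24 -> m =1 cell rho h -> (forall r, m r <= B) ->
  exists m' rho' h',
    [/\ reach P B (size l) (State off m) (State (off + size l) m'),
        size rho' = 24, m' =1 cell rho' h' & Q rho' h'].
Proof.
elim: l => [|i l IH] rho h Q P off m.
  move=> HQ _ Hs Hm Hb; exists m, rho, h; split => //; rewrite addn0.
  exact: reach_refl.
move=> Hbk Hc Hs Hm Hb.
have E0 := code_at_head Hc; have Hc' := code_at_tail Hc.
suff [m1 [r1 [h1 [Est Hs1 Hm1 Hb1 Hk1]]]] : exists m1 r1 h1,
    [/\ step P (State off m) = State off.+1 m1, size r1 = 24, m1 =1 cell r1 h1,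
        (forall r, m1 r <= B) & blk B l r1 h1 Q].
  have [m' [r' [h' [H1 H2 H3 H4]]]] := IH _ _ _ P off.+1 m1 Hk1 Hc' Hs1 Hm1 Hb1.
  exists m', r', h'; split=> //=.
  rewrite -addSnnS -add1n; apply: reach_trans H1; rewrite -Est.
  by apply: reach_step => //; rewrite Est.
have ssz d x : d < 24 -> size (set_nth 0 rho d x) = 24.
  by move=> Hd; rewrite size_set_nth Hs; apply/maxn_idPr.
have low a : a < 24 -> m a = nth 0 rho a by move=> Ha; rewrite Hm /cell Ha.
case: i E0 Hbk {Hc} => [d k|d a b|d a b|d a|a b|a|a b|] E0 //=.
- move=> [Hd Hk Hk1]; exists (upd m d k), (set_nth 0 rho d k), h.
  rewrite /step /= E0; split=> //; first exact: ssz.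
    exact: upd_cell_low.
  exact: upd_bounded.
- move=> [Hd Ha Hb' Hx Hk1]; eexists (upd m d _), (set_nth 0 rho d _), h.
  rewrite /step /= E0 !low //; split=> //; last exact: Hk1.
  + exact: ssz.
  + exact: upd_cell_low.
  + exact: upd_bounded.
- move=> [Hd Ha Hb' Hk1]; eexists (upd m d _), (set_nth 0 rho d _), h.
  rewrite /step /= E0 !low //; split=> //; last exact: Hk1.
  + exact: ssz.
  + exact: upd_cell_low.
  + apply: upd_bounded => //; rewrite -!low //.
    exact: leq_trans (leq_subr _ _) (Hb a).
- move=> [Hd Ha Hk1]; eexists (upd m d _), (set_nth 0 rho d _), h.
  rewrite /step /= E0 (low a Ha) Hm; split=> //; last exact: Hk1.
  + exact: ssz.
  + exact: upd_cell_low.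
  + by apply: upd_bounded => //; rewrite -Hm.
- move=> [Ha Hb' Hx Hk1]; eexists (upd m _ _), rho, (upd h _ _).
  rewrite /step /= E0 !low //; split=> //; last exact: Hk1.
  + exact: upd_cell_high.
  + by apply: upd_bounded => //; rewrite -low.
Qed.

(** The length is a separate [k] so that it can be evaluated to a numeral before arithmetic on [T]
    begins. *)
Lemma wp_blk B l rho h T Q k : size l = k -> k <= T ->
  blk B l rho h (fun r' h' => Q r' h' (T - k)) -> wp B (Blk l) rho h T Q.
Proof.
move=> <- HT Hk P off m Hc Hs Hm Hb.
have [m' [r' [h' [H1 H2 H3 H4]]]] := blk_correct Hk Hc Hs Hm Hb.
by exists (size l), m', r', h'; split.
Qed.

(** * Chains of boxes *)

(* [(c, b)] is the edge with larger endpoint [c]; its box spans the positions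
   [index c s .. index b s] and the values [b .. c]. A chain is listed from the
   top, inside the quadrant of positions [< x] and values [< y]. *)
Fixpoint chain (s : seq nat) (x y : nat) (l : seq (nat * nat)) : bool :=
  if l is (c, b) :: l' then
    [&& b < c, index c s < index b s, index b s < x, c < y
      & chain s (index c s) b l']
  else true.

Definition is_max (s : seq nat) (x y : nat) (l : seq (nat * nat)) : Prop :=
  chain s x y l /\ forall l', chain s x y l' -> size l' <= size l.

Lemma chain_weaken s x y x' y' l :
  x <= x' -> y <= y' -> chain s x y l -> chain s x' y' l.
Proof.
case: l => [|[c b] l] //= Hx Hy /and5P[-> -> H1 H2 ->].
by rewrite (leq_trans H1 Hx) (leq_trans H2 Hy).
Qed.

Lemma chain_size s x y l : chain s x y l -> size l <= x.
Proof.
elim: l x y => [|[c b] l IH] x y //= /and5P[_ H1 H2 _ /IH H3]; lia.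
Qed.

Lemma is_max_nil_pos s y : is_max s 0 y [::].
Proof. by split=> // -[|[c b] l'] //=; rewrite !andbF. Qed.

(** The larger endpoint of an edge stands before the smaller one. If the top edge used the value
    [y], then [y] would stand before position [x]. *)
Lemma is_max_unseen s x y l : x <= index y s -> is_max s x y l -> is_max s x y.+1 l.
Proof.
move=> Hy [Hc Hm]; split; first by apply: chain_weaken Hc.
case=> [|[c b] l'] //= /and5P[H1 H2 H3 H4 H5]; apply: (Hm ((c, b) :: l')) => /=.
rewrite H1 H2 H3 H5 andbT /=.
have : c <> y by move=> E; subst; lia.
lia.
Qed.

Lemma is_max_unseen_range s x y y' l : y <= y' ->
  (forall u, y <= u < y' -> x <= index u s) -> is_max s x y l -> is_max s x y' l.
Proof.
move=> Hy Hu Hl; have -> : y' = y + (y' - y) by lia.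
have : y + (y' - y) <= y' by lia.
elim: (y' - y) => [|k IH] Hk; first by rewrite addn0.
rewrite addnS; apply: is_max_unseen; last by apply: IH; lia.
by apply: Hu; lia.
Qed.

Lemma index_nth_eq s i b : i < size s -> index b s = i -> b = nth 0 s i.
Proof. by move=> Hi E; rewrite -E nth_index // -index_mem E. Qed.

(** An edge gained by admitting position [i] would have the new value as its smaller endpoint, but
    that value is not below [y]. *)
Lemma is_max_new_low s i y l : i < size s -> y <= nth 0 s i ->
  is_max s i y l -> is_max s i.+1 y l.
Proof.
move=> Hi Hy [Hc Hm]; split; first by apply: chain_weaken Hc.
case=> [|[c b] l'] //= /and5P[H1 H2 H3 H4 H5]; apply: (Hm ((c, b) :: l')) => /=.
rewrite H1 H2 H4 H5 !andbT /=.
case: (eqVneq (index b s) i) => [/(index_nth_eq Hi) E|]; lia.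
Qed.

(** The new value is the largest of this quadrant and stands at its last position, so it is neither
    the smaller nor the larger endpoint of an edge inside. *)
Lemma is_max_new s i l : uniq s -> i < size s ->
  is_max s i (nth 0 s i) l -> is_max s i.+1 (nth 0 s i).+1 l.
Proof.
move=> U Hi [Hc Hm]; split; first by apply: chain_weaken Hc.
case=> [|[c b] l'] //= /and5P[H1 H2 H3 H4 H5]; apply: (Hm ((c, b) :: l')) => /=.
rewrite H1 H2 H5 !andbT /=.
have Hb : index b s <> i by move=> /(index_nth_eq Hi) E; lia.
have Ha : index (nth 0 s i) s = i by rewrite index_uniq.
have Hc' : c <> nth 0 s i by move=> E; subst c; lia.
lia.
Qed.

(* The topmost edge either ends before position [i], or has top below [c], or is
   the edge between [c] and the new element. *)
Lemma is_max_update s i c l1 l2 lq l : i < size s ->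
  nth 0 s i < c -> index c s < i -> index (nth 0 s i) s = i ->
  is_max s i c.+1 l1 -> is_max s i.+1 c l2 -> is_max s (index c s) (nth 0 s i) lq ->
  l \in [:: l1; l2; (c, nth 0 s i) :: lq] ->
  size l1 <= size l -> size l2 <= size l -> (size lq).+1 <= size l ->
  is_max s i.+1 c.+1 l.
Proof.
move=> Hi Hac Hci Hia [C1 M1] [C2 M2] [Cq Mq] Hl S1 S2 S3; split.
  move: Hl; rewrite !inE => /or3P[]/eqP->.
  - exact: chain_weaken C1.
  - exact: chain_weaken C2.
  - by rewrite /= Hac Hia Hci !ltnS !leqnn Cq.
case=> [|[c' b] l'] //= /and5P[H1 H2 H3 H4 H5].
case: (ltnP c' c) => Hc'.
  apply: leq_trans S2; apply: (M2 ((c', b) :: l')) => /=.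
  by rewrite H1 H2 H3 Hc' H5.
have Ec : c' = c by lia.
subst c'.
case: (ltnP (index b s) i) => Hb.
  apply: leq_trans S1; apply: (M1 ((c, b) :: l')) => /=.
  by rewrite H1 H2 Hb H4 H5.
have /(index_nth_eq Hi) Eb : index b s = i by lia.
by apply: leq_trans S3; rewrite ltnS; apply: Mq; rewrite -Eb.
Qed.

(** * Chains and induced matchings *)

Definition swap (e : nat * nat) : nat * nat := (e.2, e.1).

Lemma chain_mem s x y l (e : nat * nat) : chain s x y l -> e \in l ->
  [/\ e.2 < e.1, index e.1 s < index e.2 s, index e.2 s < x & e.1 < y].
Proof.
elim: l x y => [|[c b] l IH] x y //= /and5P[H1 H2 H3 H4 H5].
rewrite inE => /orP[/eqP-> //|/(IH _ _ H5) [G1 G2 G3 G4]]; split=> //; lia.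
Qed.

Lemma chain_comparable s x y l (e1 e2 : nat * nat) :
  chain s x y l -> e1 \in l -> e2 \in l -> e1 != e2 ->
  (index e1.2 s < index e2.1 s /\ e1.1 < e2.2) \/
  (index e2.2 s < index e1.1 s /\ e2.1 < e1.2).
Proof.
elim: l x y => [|[c b] l IH] x y //= /and5P[H1 H2 H3 H4 H5].
rewrite !inE => /orP[/eqP->|M1] /orP[/eqP->|M2] Hne.
- by rewrite eqxx in Hne.
- by right; have [] := chain_mem H5 M2.
- by left; have [] := chain_mem H5 M1.
- exact: IH H5 M1 M2 Hne.
Qed.

Lemma chain_uniq s x y l : chain s x y l -> uniq l.
Proof.
elim: l x y => [|[c b] l IH] x y //= /and5P[H1 H2 H3 H4 H5].
rewrite (IH _ _ H5) andbT; apply/negP => /(chain_mem H5) /= [_]; lia.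
Qed.

Lemma perm_iota_mem n s u : perm_eq s (iota 1 n) -> (u \in s) = (0 < u <= n).
Proof. by move=> /perm_mem ->; rewrite mem_iota add1n ltnS. Qed.

Lemma pedgeP n s u v : perm_eq s (iota 1 n) -> 0 < u <= n -> 0 < v <= n ->
  pedge s u v = ((u < v) && (index v s < index u s)) || ((v < u) && (index u s < index v s)).
Proof.
move=> Hp Hu Hv; have E : size s = n by rewrite (perm_size Hp) size_iota.
by rewrite /pedge /in_V E Hu Hv /pos !ltnS.
Qed.

Lemma index_bound n s u : perm_eq s (iota 1 n) -> index u s < n -> 0 < u <= n.
Proof.
move=> Hp Hi; rewrite -(perm_iota_mem _ Hp) -index_mem.
by rewrite (perm_size Hp) size_iota.
Qed.

(** For comparable boxes, positions and values of endpoints from different edges are ordered the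
    same way, so no such pair is an inversion. *)
Lemma chain_induced_matching n s y l : perm_eq s (iota 1 n) -> chain s n y l ->
  induced_matching s (map swap l).
Proof.
move=> Hp Hl.
have Hin (e : nat * nat) : e \in l -> 0 < e.1 <= n /\ 0 < e.2 <= n.
  move=> /(chain_mem Hl) [H1 H2 H3 H4].
  by split; apply: (index_bound Hp); lia.
split.
- rewrite map_inj_uniq ?(chain_uniq Hl) // => -[a b] [a' b'] /=.
  by case=> -> ->.
- move=> _ /mapP[e He ->] /=; have [H1 H2 H3 H4] := chain_mem Hl He.
  by have [B1 B2] := Hin e He; rewrite (pedgeP Hp) // H1 H2.
- move=> _ _ /mapP[e1 He1 ->] /mapP[e2 He2 ->] Hne.
  have Hne' : e1 != e2 by apply: contraNneq Hne => ->.
  have [H1 H2 H3 H4] := chain_mem Hl He1.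
  have [G1 G2 G3 G4] := chain_mem Hl He2.
  have [B1 B2] := Hin e1 He1; have [C1 C2] := Hin e2 He2.
  by rewrite !(pedgeP Hp) //=; case: (chain_comparable Hl He1 He2 Hne') => -[]; lia.
Qed.

Lemma index_neq (s : seq nat) u v : u \in s -> u <> v -> index u s <> index v s.
Proof.
move=> Hu Hne E; apply: Hne; rewrite -(nth_index 0 Hu) E nth_index //.
by rewrite -index_mem -E index_mem.
Qed.

(** Nonadjacency puts both endpoints of [e1] before [e2.2], which itself stands before [e2.1]. A
    value [e2.1] below [e1.2] would then form an inversion with it, and equality is excluded by the
    positions. *)
Lemma matching_comparable n s M (e1 e2 : nat * nat) : perm_eq s (iota 1 n) ->
  induced_matching s M -> e1 \in M -> e2 \in M -> e1 != e2 -> e1.2 <= e2.2 ->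
  index e1.1 s < index e2.2 s /\ e1.2 < e2.1.
Proof.
move=> Hp [U HE HX] M1 M2 Hne Hle.
have [L1 P1] := HE _ M1; have [L2 P2] := HE _ M2.
have [X1 [X2 [X3 X4]]] := HX _ _ M1 M2 Hne.
have E : size s = n by rewrite (perm_size Hp) size_iota.
have inV u v : pedge s u v -> 0 < u <= n /\ 0 < v <= n.
  by rewrite /pedge /in_V E => /and3P[].
have [B1 B2] := inV _ _ P1; have [C1 C2] := inV _ _ P2.
have ms u : 0 < u <= n -> u \in s by rewrite (perm_iota_mem _ Hp).
have N u v : 0 < u <= n -> u <> v -> index u s <> index v s.
  by move=> Hu; apply: index_neq; apply: ms.
rewrite !(pedgeP Hp) // in P1 P2 X2 X3 X4.
have Q1 : index e1.2 s < index e1.1 s.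
  by case/orP: P1 => /andP[//]; rewrite ltnNge (ltnW L1).
have Q2 : index e2.2 s < index e2.1 s.
  by case/orP: P2 => /andP[//]; rewrite ltnNge (ltnW L2).
(* A shared larger endpoint would make [e1.2] adjacent to [e2.1]. *)
have Hlt : e1.2 < e2.2.
  rewrite ltn_neqAle Hle andbT; apply/eqP => Eq.
  by move: X3; rewrite Eq L2 Q2 orbT.
have H4 : index e1.2 s < index e2.2 s.
  move: X4; rewrite Hlt /= negb_or -leqNgt => /andP[X4 _].
  by rewrite ltn_neqAle X4 andbT; apply/eqP/N => // Eq; rewrite Eq ltnn in Hlt.
have L12 := ltn_trans L1 Hlt.
split.
  move: X2; rewrite L12 /= negb_or -leqNgt => /andP[X2 _].
  by rewrite ltn_neqAle X2 andbT; apply/eqP/N => // Eq; rewrite Eq ltnn in L12.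
rewrite ltnNge leq_eqVlt; apply/negP => /orP[/eqP Eq|Hgt].
  by move: (ltn_trans H4 Q2); rewrite Eq ltnn.
by move: X3; rewrite Hgt (ltn_trans H4 Q2) orbT.
Qed.

Lemma sorted_matching_chain n s (M l : seq (nat * nat)) x y :
  perm_eq s (iota 1 n) -> induced_matching s M -> uniq l -> {subset l <= M} ->
  pairwise (fun e e' => e'.2 <= e.2) l ->
  (forall e, e \in l -> index e.1 s < x /\ e.2 < y) -> chain s x y (map swap l).
Proof.
move=> Hp HM; elim: l x y => [|e l IH] x y //= /andP[Ul1 Ul2] Sub /andP[A1 A2] Hxy.
have Me : e \in M by apply: Sub; rewrite inE eqxx.
have [U HE HX] := HM; have [L1 P1] := HE _ Me.
have E : size s = n by rewrite (perm_size Hp) size_iota.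
have [B1 B2] : 0 < e.1 <= n /\ 0 < e.2 <= n.
  by move: P1; rewrite /pedge /in_V E => /and3P[].
rewrite (pedgeP Hp) // in P1.
have [H1 H2] : index e.1 s < x /\ e.2 < y by apply: Hxy; rewrite inE eqxx.
rewrite L1 H1 H2 /=; apply/andP; split.
  by case/orP: P1 => /andP[//]; rewrite ltnNge (ltnW L1).
apply: IH => //; first by move=> e' He'; apply: Sub; rewrite inE He' orbT.
move=> e' He'; apply: (matching_comparable Hp HM) => //.
- by apply: Sub; rewrite inE He' orbT.
- by apply: contraNneq Ul1 => <-.
- by move/allP: A1 => /(_ _ He').
Qed.

(** Sorting by decreasing larger endpoint lists the edges from the top, as a chain requires. *)
Lemma matching_chain n s M : perm_eq s (iota 1 n) -> induced_matching s M ->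
  exists2 l, chain s n n.+1 l & size l = size M.
Proof.
move=> Hp HM; pose r (e e' : nat * nat) := e'.2 <= e.2.
have E : size s = n by rewrite (perm_size Hp) size_iota.
exists (map swap (sort r M)); last by rewrite size_map size_sort.
apply: (sorted_matching_chain Hp HM).
- by rewrite sort_uniq; case: HM.
- by move=> e; rewrite mem_sort.
- rewrite -sorted_pairwise; last by move=> a b c; rewrite /r; lia.
  by apply: sort_sorted => a b; rewrite /r; lia.
- move=> e; rewrite mem_sort => He; have [_ HE _] := HM.
  have [L1 P1] := HE _ He.
  have [B1 B2] : 0 < e.1 <= n /\ 0 < e.2 <= n.
    by move: P1; rewrite /pedge /in_V E => /and3P[].
  split; last by case/andP: B2.
  by rewrite -E index_mem (perm_iota_mem _ Hp).
Qed.

Lemma is_max_matching n s y l : perm_eq s (iota 1 n) -> n < y -> is_max s n y l ->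
  max_induced_matching s (map swap l).
Proof.
move=> Hp Hy [Hc Hm]; split; first exact: chain_induced_matching Hc.
move=> M /(matching_chain Hp) [l' Hl' <-]; rewrite size_map.
by apply: Hm; apply: chain_weaken Hl'.
Qed.

(** * Neighbour counts and the number of edges *)

Definition rdeg (s : seq nat) (a : nat) : nat :=
  count (fun u => index a s <= index u s) (iota 1 a.-1).

Definition ldeg (s : seq nat) (a : nat) : nat :=
  count (fun u => index u s < index a s) (iota a.+1 (size s - a)).

Lemma rdegE n s a : perm_eq s (iota 1 n) -> 0 < a <= n ->
  rdeg s a = \sum_(1 <= u < n.+1) ((u < a) && pedge s u a).
Proof.
move=> Hp Ha; rewrite /rdeg -sum1_count big_mkcond /=.
rewrite (@big_cat_nat _ _ _ a) /=; [|lia|lia].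
rewrite [X in _ = _ + X]big1_seq; last first.
  by move=> u /andP[_]; rewrite mem_index_iota => Hu; rewrite ltnNge; case/andP: Hu => ->.
rewrite addn0 /index_iota subn1; apply: eq_big_seq => u.
rewrite mem_iota => Hu; rewrite (pedgeP Hp) //; last lia.
have Hua : u < a by lia.
have : index a s <> index u s.
  by apply: index_neq; [rewrite (perm_iota_mem _ Hp)|lia].
by rewrite Hua /=; case: ifP; lia.
Qed.

Lemma ldegE n s a : perm_eq s (iota 1 n) -> 0 < a <= n ->
  ldeg s a = \sum_(1 <= v < n.+1) ((a < v) && pedge s a v).
Proof.
move=> Hp Ha; rewrite /ldeg -sum1_count big_mkcond /=.
have E : size s = n by rewrite (perm_size Hp) size_iota.
rewrite (@big_cat_nat _ _ _ a.+1) /=; [|lia|lia].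
rewrite [X in _ = X + _]big1_seq; last first.
  by move=> u /andP[_]; rewrite mem_index_iota ltnS => Hu; rewrite ltnNge; case/andP: Hu => _ ->.
rewrite add0n E /index_iota subSS; apply: eq_big_seq => u.
rewrite mem_iota => Hu; rewrite (pedgeP Hp) //; last lia.
have Hau : a < u by lia.
by rewrite Hau /= [u < a]ltnNge; case: ifP; lia.
Qed.

(** Each edge is counted once at either end: by [rdeg] at its larger endpoint and by [ldeg] at its
    smaller one. *)
Lemma sum_deg n s : perm_eq s (iota 1 n) ->
  \sum_(a <- s) (rdeg s a + ldeg s a) = 2 * num_edges s.
Proof.
move=> Hp; rewrite (perm_big _ Hp) /= big_split /=.
have E : size s = n by rewrite (perm_size Hp) size_iota.
have H f g : (forall a, 0 < a <= n -> f a = g a) ->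
    \sum_(a <- iota 1 n) f a = \sum_(1 <= a < n.+1) g a.
  rewrite /index_iota subSS subn0 => Hfg; apply: eq_big_seq => a.
  by rewrite mem_iota => Ha; apply: Hfg; lia.
rewrite (H _ _ (fun a => @rdegE n s a Hp)) (H _ _ (fun a => @ldegE n s a Hp)).
by rewrite exchange_big /= /num_edges E; lia.
Qed.

(** * The sweep *)

Lemma blk_const B d k l rho h Q : d < 24 -> k <= B ->
  blk B l (set_nth 0 rho d k) h Q -> blk B (IConst d k :: l) rho h Q.
Proof. by []. Qed.

Lemma blk_add B d a b l rho h Q : d < 24 -> a < 24 -> b < 24 ->
  nth 0 rho a + nth 0 rho b <= B ->
  blk B l (set_nth 0 rho d (nth 0 rho a + nth 0 rho b)) h Q ->
  blk B (IAdd d a b :: l) rho h Q.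
Proof. by []. Qed.

Lemma blk_sub B d a b l rho h Q : d < 24 -> a < 24 -> b < 24 ->
  blk B l (set_nth 0 rho d (nth 0 rho a - nth 0 rho b)) h Q ->
  blk B (ISub d a b :: l) rho h Q.
Proof. by []. Qed.

Lemma blk_load B d a l rho h Q : d < 24 -> a < 24 -> 24 <= nth 0 rho a ->
  blk B l (set_nth 0 rho d (h (nth 0 rho a))) h Q ->
  blk B (ILoad d a :: l) rho h Q.
Proof. by move=> Hd Ha Hx H; split=> //; rewrite cell_heap. Qed.

Lemma blk_load_val B d a x l rho h Q : d < 24 -> a < 24 ->
  cell rho h (nth 0 rho a) = x ->
  blk B l (set_nth 0 rho d x) h Q ->
  blk B (ILoad d a :: l) rho h Q.
Proof. by move=> Hd Ha Hx H; split=> //; rewrite Hx. Qed.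

Lemma blk_store B a b l rho h Q : a < 24 -> b < 24 -> 24 <= nth 0 rho a ->
  blk B l rho (upd h (nth 0 rho a) (nth 0 rho b)) Q ->
  blk B (IStore a b :: l) rho h Q.
Proof. by []. Qed.

Ltac bs := cbn [nth set_nth].
Ltac bstep :=
  lazymatch goal with
  | |- blk _ [::] ?rho ?h ?Q =>
      let g := eval cbv beta in (Q rho h) in change g; bs
  | |- blk _ (IConst _ _ :: _) _ _ _ => apply: blk_const; [by []|try lia|bs]
  | |- blk _ (IAdd _ _ _ :: _) _ _ _ =>
      apply: blk_add; [by []|by []|by []|bs; try lia|bs]
  | |- blk _ (ISub _ _ _ :: _) _ _ _ => apply: blk_sub; [by []|by []|by []|bs]
  | |- blk _ (ILoad _ _ :: _) _ _ _ => apply: blk_load; [by []|by []|bs; try lia|bs]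
  | |- blk _ (IStore _ _ :: _) _ _ _ => apply: blk_store; [by []|by []|bs; try lia|bs]
  end.

(** * Memory layout and stored chains *)

(* Registers: 0 and 1 hold constants, 2-8 multiples of the row width [S], 9 the
   sentinel above all values, 10 the number of relocated cells; then the
   one-based position, its node row, its value, and scratch. *)
Definition rg (S i row a v w q p z t d u : nat) : seq nat :=
  [:: 0; 1; S; 2 * S; 3 * S; 4 * S; 5 * S; 6 * S; 8 * S; S - 1; 23;
      i; row; a; v; w; q; p; z; t; d; u; 0; 0].

(* Heap rows, each of width [S]: 1 relocated input cells, 2 best chain below a
   value, 3 gap to the next unseen value, 4 previous seen value, 5 next seen
   value, 6 node row of a seen value; rows [8(p+1)] to [8(p+1)+3] hold length,
   tail, larger and smaller endpoint of the nodes of position [p]. *)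
Definition nrow (S p : nat) : nat := p.+1 * (8 * S).

(** The width is [64 * n - 1] because relocation finds its first free address, [S + 1], by doubling
    [n] six times. The bound on [B] covers the node rows of all positions. *)
Definition ctx (B S n : nat) (s : seq nat) : Prop :=
  [/\ perm_eq s (iota 1 n), 0 < n, S = 64 * n - 1 & S * (8 * n + 24) <= B].

Lemma nrow_lt S p i : p < i -> nrow S p + 8 * S <= nrow S i.
Proof. by move=> H; rewrite /nrow; nia. Qed.

Lemma nrow_ge S i : 8 * S <= nrow S i.
Proof. by rewrite /nrow; nia. Qed.

Lemma nrow_bound B S n s i : ctx B S n s -> i <= n -> nrow S i + 8 * S <= B.
Proof. by move=> [_ _ _ HB] Hi; apply: leq_trans HB; rewrite /nrow; nia. Qed.

Lemma ctx_size B S n s : ctx B S n s -> size s = n.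
Proof. by move=> [Hp _ _ _]; rewrite (perm_size Hp) size_iota. Qed.

Lemma ctx_uniq B S n s : ctx B S n s -> uniq s.
Proof. by move=> [Hp _ _ _]; rewrite (perm_uniq Hp) iota_uniq. Qed.

Lemma ctx_bound B S n s i u : ctx B S n s -> i <= n -> index u s < i -> 0 < u <= n.
Proof. by move=> [Hp _ _ _] Hi Hu; apply: (index_bound Hp); lia. Qed.

Lemma ctx_S B S n s : ctx B S n s -> 62 < S /\ n + 10 < S.
Proof. by move=> [_ Hn -> _]; lia. Qed.

(** A linked list with the length cached in each node. The address of a node is determined by its
    edge, so chains can share tails. *)
Fixpoint lch (s : seq nat) (S : nat) (h : nat -> nat) (q : nat)
    (l : seq (nat * nat)) : Prop :=
  if l is (c, b) :: l' then
    [/\ q = nrow S (index c s) + b, h q = (size l').+1, h (q + S + S) = c,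
        h (q + S + S + S) = b & lch s S h (h (q + S)) l']
  else q = 0.

Definition rep s S h i y q : Prop := exists2 l, is_max s i y l & lch s S h q l.

(** Edges of a chain in the first [i] positions have their larger endpoint before [i], so their
    nodes lie below [nrow S i] and survive the filling of that row. *)
Lemma lch_frame B S n s h h' i y l q : ctx B S n s -> i <= n -> chain s i y l ->
  (forall z, 8 * S <= z < nrow S i -> h' z = h z) ->
  lch s S h q l -> lch s S h' q l.
Proof.
move=> Hx; elim: l i y q => [|[c b] l IH] i y q //= Hi /and5P[H1 H2 H3 H4 H5] Hf.
move=> [G1 G2 G3 G4 G5].
have Hb := ctx_bound Hx Hi H3; have [S1 S2] := ctx_S Hx.
have R1 := @nrow_lt S (index c s) i ltac:(lia).
have R2 := nrow_ge S (index c s).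
split=> //; try by rewrite Hf //; lia.
rewrite Hf; last lia.
apply: IH H5 _ G5; first by lia.
by move=> z Hz; apply: Hf; lia.
Qed.

Lemma rep_frame B S n s h h' i y q : ctx B S n s -> i <= n ->
  (forall z, 8 * S <= z < nrow S i -> h' z = h z) ->
  rep s S h i y q -> rep s S h' i y q.
Proof.
move=> Hx Hi Hf [l Hl Hq]; exists l => //.
by apply: lch_frame Hx Hi (proj1 Hl) Hf Hq.
Qed.

(** The null pointer reads register 0, whose content 0 is the length of the empty chain; hence the
    code does not test for null. *)
Lemma lch_len S s h q l rho : 24 <= S -> nth 0 rho 0 = 0 -> lch s S h q l ->
  cell rho h q = size l.
Proof.
move=> HS H0; case: l => [|[c b] l] /=; first by move=> ->; rewrite /cell H0.
move=> [E H _ _ _]; rewrite cell_heap //.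
have := nrow_ge S (index c s); lia.
Qed.

(* Row 3 stores gaps rather than successors, so that zeroed memory already encodes
   the list of all values. *)
Definition next_spec (s : seq nat) (S n i : nat) (h : nat -> nat) : Prop :=
  forall v, v <= n -> i <= index v s ->
    let w := h (3 * S + v) + v + 1 in
    [/\ w <= n.+1, i <= index w s & forall u, v < u < w -> index u s < i].

(** The node of an edge is built when [c] is read, possibly long before [b] is: its tail concerns
    only positions before [c]. *)
Definition node s S h c b : Prop :=
  exists2 l, is_max s (index c s) b l
           & lch s S h (nrow S (index c s) + b) ((c, b) :: l).

(** The truncated difference in register 20 is the loop test: it vanishes once the next unseen value
    is no longer below the current value. *)
Definition NEXT : seq instr :=
  [:: IAdd 19 4 14; ILoad 15 19; IAdd 15 15 14; IAdd 15 15 1; ISub 20 13 15].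

Ltac bstart :=
  apply: wp_blk; [vm_compute; reflexivity|try lia|cbv [NEXT cat rg]].

(* For the unseen values [b < a] upwards: copy the best chain of [b - 1] to [b] and
   make it the tail of the node of the edge [(a, b)]. *)
Definition LOOP1 : cmd :=
  Wh 20 (Blk ([:: IAdd 19 3 15; ISub 18 19 1; ILoad 17 18; IStore 19 17;
     IAdd 18 12 15; ILoad 20 17; IAdd 20 20 1; IStore 18 20;
     IAdd 18 18 2; IStore 18 17; IAdd 18 18 2; IStore 18 13;
     IAdd 18 18 2; IStore 18 15; IAdd 14 15 0] ++ NEXT)).

(** Here [h0] is the heap on entry, [w] the next unseen value to treat and [v] the one before it. At
    exit [v] is the unseen predecessor of the new value, from which that value is later unlinked. *)
Definition inv1 s S n i h0 h v w : Prop :=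
  let a := nth 0 s i in
  [/\ (forall x, x < 2 * S \/ 3 * S <= x < nrow S i -> h x = h0 x),
      [/\ 0 < w <= a, i <= index w s, v <= n, i <= index v s
        & h0 (3 * S + v) + v + 1 = w],
      (forall u, u < w \/ index u s < i -> rep s S h i u.+1 (h (2 * S + u)))
    & (forall b, 0 < b < w -> i <= index b s -> node s S h a b)].

Lemma ctx_nth B S n s i : ctx B S n s -> i < n ->
  0 < nth 0 s i <= n /\ index (nth 0 s i) s = i.
Proof.
move=> Hx Hi; have E := ctx_size Hx; split; last first.
  by rewrite index_uniq ?E // (ctx_uniq Hx).
by case: (Hx) => Hp _ _ _; rewrite -(perm_iota_mem _ Hp) mem_nth // E.
Qed.

(** The induction is on a bound [k] for the unseen values left below the new one; 30 bounds the
    steps of one round. *)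
Lemma loop1_correct B S n s i q u h0 : ctx B S n s -> i < n ->
  next_spec s S n i h0 ->
  forall k h v w p z t T (Q : seq nat -> (nat -> nat) -> nat -> Prop),
  inv1 s S n i h0 h v w ->
  count (fun x => i <= index x s) (iota w (nth 0 s i - w)) <= k ->
  30 * k < T ->
  (forall h' v' p' z' t' T', inv1 s S n i h0 h' v' (nth 0 s i) ->
     T <= T' + 30 * k + 1 ->
     Q (rg S i.+1 (nrow S i) (nth 0 s i) v' (nth 0 s i) q p' z' t' 0 u) h' T') ->
  wp B LOOP1 (rg S i.+1 (nrow S i) (nth 0 s i) v w q p z t (nth 0 s i - w) u) h T Q.
Proof.
move=> Hx Hi Hn; have [Ha Hia] := ctx_nth Hx Hi.
set a := nth 0 s i in Ha Hia *.
have [S1 S2] := ctx_S Hx; have RB := nrow_bound Hx (ltnW Hi); have RG := nrow_ge S i.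
elim=> [|k IH] h v w p z t T Q Hinv Hk HT HQ; have [F1 [W1 W2 W3 W4 W5] F2 F3] := Hinv.
  (* As [w] is itself unseen, a count of zero forces it to have reached [a]. *)
  have Ew : w = a.
    apply/eqP; rewrite eqn_leq; case/andP: W1 => _ -> /=; rewrite leqNgt; apply/negP=> Hlt.
    by move: Hk; have -> : a - w = (a - w).-1.+1 by [lia]; rewrite /= W2.
  rewrite Ew subnn in Hinv *; apply: wp_wh_stop => //.
  by apply: HQ Hinv _; lia.
case: (eqVneq w a) => [Ew|Nw].
  rewrite Ew subnn in Hinv *; apply: wp_wh_stop => //; first by lia.
  by apply: HQ Hinv _; lia.
have {}Nw : w < a by lia.
apply: wp_wh_go => //; [by lia|by rewrite /=; lia|].
bstart; do 2 bstep.
(* Entry [w - 1] of row 2 holds F(i, w), since all entries below [w] are valid. *)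
have [l Hl Hq] : rep s S h i w (h (2 * S + w - 1)).
  have -> : 2 * S + w - 1 = 2 * S + w.-1 by lia.
  by have -> : w = w.-1.+1 by [lia]; apply: F2; lia.
bstep. set pp := h _ in Hq *.
bstep. bstep.
set h1 := upd _ _ _.
have Hq1 : lch s S h1 pp l.
  apply: lch_frame Hx (ltnW Hi) (proj1 Hl) _ Hq => y Hy.
  by rewrite /h1 upd_ne //; lia.
have lenB : size l <= i := chain_size (proj1 Hl).
apply: blk_load_val; [by []|by []|bs; apply: lch_len Hq1 => //; lia|bs].
do 9 bstep.
set h2 := upd h1 _ _; set h3 := upd h2 _ _; set h4 := upd h3 _ _; set h5 := upd h4 _ _.
have F5 x : x < nrow S i -> x <> 2 * S + w -> h5 x = h x.
  by move=> H1 H2; rewrite /h5 upd_ne /h4 ?upd_ne /h3 ?upd_ne /h2 ?upd_ne /h1 ?upd_ne //; lia.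
have Fl y q' l' : chain s i y l' -> lch s S h q' l' -> lch s S h5 q' l'.
  move=> Hc; apply: lch_frame Hx (ltnW Hi) Hc _ => x Hxx; apply: F5; lia.
have F5b : h5 (2 * S + w) = pp.
  by rewrite /h5 upd_ne /h4 ?upd_ne /h3 ?upd_ne /h2 ?upd_ne /h1 ?upd_eq //; lia.
have E3 : h5 (3 * S + w) = h0 (3 * S + w).
  by rewrite F5 ?F1 //; lia.
have [N1 N2 N3] := Hn w ltac:(lia) W2.
rewrite addn0; do 6 bstep.
split; first by lia.
set w' := h5 _ + w + 1.
have Ew' : w' = h0 (3 * S + w) + w + 1 by rewrite /w' E3.
rewrite -Ew' in N1 N2 N3.
(* The links cannot skip [a], which is still unseen. *)
have Hwa : w' <= a.
  rewrite leqNgt; apply/negP => Hlt.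
  by have := N3 a ltac:(lia); rewrite Hia ltnn.
apply: IH.
- split.
  + by move=> x Hxx; rewrite F5 ?F1 //; lia.
  + by split=> //; lia.
  + move=> x Hxx.
    case: (eqVneq x w) => [->|Nxw].
      exists l; last by rewrite F5b; apply: Fl (proj1 Hl) Hq.
      exact: is_max_unseen Hl.
    have Hx1 : x < w \/ index x s < i.
      case: Hxx => Hxx; last by right.
      by case: (ltnP x w) => Hc; [left|right; apply: N3; lia].
    have Hxn : x <= n.
      by case: Hx1 => H; [lia|have := ctx_bound Hx (ltnW Hi) H; lia].
    rewrite F5; [|lia|lia].
    apply: rep_frame Hx (ltnW Hi) _ (F2 x Hx1) => y Hy; apply: F5; lia.
  + move=> b Hb Ub; case: (eqVneq b w) => [->|Nb].
      exists l; first by rewrite Hia.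
      split=> //; rewrite ?Hia.
      * by rewrite /h5 upd_ne /h4 ?upd_ne /h3 ?upd_ne /h2 ?upd_eq ?addn1 //; lia.
      * by rewrite /h5 upd_ne /h4 ?upd_eq //; lia.
      * by rewrite /h5 upd_eq.
      * have -> : h5 (nrow S i + w + S) = pp.
          by rewrite /h5 upd_ne /h4 ?upd_ne /h3 ?upd_eq //; lia.
        exact: Fl (proj1 Hl) Hq.
    have Hbw : b < w.
      rewrite ltnNge; apply/negP => Hge; have := N3 b ltac:(lia); lia.
    have [l' Hl' [G1 G2 G3 G4 G5]] := F3 b ltac:(lia) Ub.
    have F6 x y : x = nrow S i + b + y * S -> y < 4 -> h5 x = h x.
      move=> -> Hy.
      have : y = 0 \/ y = 1 \/ y = 2 \/ y = 3 by lia.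
      by case=> [->|[->|[->|->]]];
        rewrite /h5 upd_ne /h4 ?upd_ne /h3 ?upd_ne /h2 ?upd_ne /h1 ?upd_ne //; lia.
    exists l' => //; rewrite Hia in Hl' G1 G2 G3 G4 G5 *.
    split=> /=.
    * by rewrite -/a Hia.
    * by rewrite (F6 _ 0) //; lia.
    * by rewrite (F6 _ 2) //; lia.
    * by rewrite (F6 _ 3) //; lia.
    * by rewrite (F6 _ 1) //; [apply: Fl (proj1 Hl') G5|lia].
- move: Hk.
  have -> : a - w = 1 + (w' - w.+1) + (a - w') by lia.
  rewrite -addnA iotaD count_cat iotaD count_cat /= W2.
  have -> : w + 1 + (w' - w.+1) = w' by lia.
  lia.
- lia.
- move=> h' v' p' z' t' T' Hi' HT'; apply: HQ Hi' _; lia.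
Qed.

(** Seen values are linked downwards from the sentinel [S - 1], with 0 as the end mark. *)
Definition prev_spec (s : seq nat) (S i : nat) (h : nat -> nat) : Prop :=
  forall v, v = S - 1 \/ index v s < i ->
    let w := h (4 * S + v) in
    [/\ w < v, w = 0 \/ index w s < i & forall u, w < u < v -> i <= index u s].

(** Upward links are not kept between arrivals. Each walk down rebuilds them, and they hold from
    [lo] upwards. *)
Definition up_spec (s : seq nat) (S i : nat) (h : nat -> nat) (lo : nat) : Prop :=
  forall c, lo <= c -> index c s < i ->
    let d := h (5 * S + c) in
    [/\ c < d, d = S - 1 \/ index d s < i & forall u, c < u < d -> i <= index u s].

(* Walk down the seen values above [a], recording the way back in row 5. *)
Definition LOOP2 : cmd :=
  Wh 20 (Blk [:: IAdd 19 6 15; IStore 19 21; IAdd 21 15 0; IAdd 19 5 21;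
                 ILoad 15 19; ISub 20 15 13]).

Definition inv2 s S i h0 h u w : Prop :=
  [/\ (forall x, x < 5 * S \/ 6 * S <= x -> h x = h0 x),
      u = S - 1 \/ index u s < i, nth 0 s i < u, w = h0 (4 * S + u)
    & up_spec s S i h u].

(** The links of row 4 skip only unseen values, so each round of the walk is paid for by one seen
    value above the new one. *)
Lemma loop2_correct B S n s i v q p z h0 : ctx B S n s -> i < n ->
  prev_spec s S i h0 ->
  forall k h u w t T (Q : seq nat -> (nat -> nat) -> nat -> Prop),
  inv2 s S i h0 h u w ->
  count (fun x => index x s < i) (iota (nth 0 s i).+1 (u - (nth 0 s i).+1)) <= k ->
  30 * k < T ->
  (forall h' u' w' t' T', inv2 s S i h0 h' u' w' -> w' < nth 0 s i ->
     T <= T' + 30 * k + 1 ->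
     Q (rg S i.+1 (nrow S i) (nth 0 s i) v w' q p z t' 0 u') h' T') ->
  wp B LOOP2 (rg S i.+1 (nrow S i) (nth 0 s i) v w q p z t (w - nth 0 s i) u) h T Q.
Proof.
move=> Hx Hi Hn; have [Ha Hia] := ctx_nth Hx Hi.
set a := nth 0 s i in Ha Hia *.
have [S1 S2] := ctx_S Hx; have RB := nrow_bound Hx (ltnW Hi); have RG := nrow_ge S i.
elim/ltn_ind=> k IH h u w t T Q Hinv Hk HT HQ; have [F1 W1 W2 W3 F2] := Hinv.
have [P1 P2 P3] := Hn u W1; rewrite -W3 in P1 P2 P3.
case: (leqP w a) => Hwa.
  (* The walk cannot stop on [a], which is not yet linked. *)
  have Nwa : w <> a by move=> E; case: P2 => P2; [lia|rewrite E Hia ltnn in P2].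
  have E0 : w - a = 0 by lia.
  rewrite E0; apply: wp_wh_stop => //; first by lia.
  by apply: HQ Hinv _ _; lia.
have Hws : index w s < i by case: P2 => //; lia.
have Hwn := ctx_bound Hx (ltnW Hi) Hws.
have Hun : u < S.
  by case: W1 => [->|/(ctx_bound Hx (ltnW Hi))]; lia.
have Hk0 : count (fun x => index x s < i) (iota a.+1 (w - a.+1)) < k.
  apply: leq_trans Hk.
  have -> : u - a.+1 = (w - a.+1) + (1 + (u - w.+1)) by lia.
  rewrite iotaD count_cat iotaD count_cat.
  have -> : a.+1 + (w - a.+1) = w by lia.
  by rewrite /= Hws; lia.
apply: wp_wh_go => //; [by lia|by rewrite /=; lia|].
bstart; do 3 bstep; rewrite addn0.
set h1 := upd _ _ _.
have F x : x <> 5 * S + w -> h1 x = h x by move=> H; rewrite /h1 upd_ne.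
have E4 : h1 (4 * S + w) = h0 (4 * S + w) by rewrite F ?F1 //; lia.
do 4 bstep; split; first by lia.
apply: (IH k.-1); first by lia.
- split=> //; last 1 first.
  + move=> c Hc Sc.
    case: (eqVneq c w) => [->|Ncw].
      by rewrite /h1 upd_eq; split=> //; lia.
    have Hcu : u <= c.
      by rewrite leqNgt; apply/negP => Hlt; have := P3 c ltac:(lia); lia.
    have := F2 c Hcu Sc.
    have Hcn := ctx_bound Hx (ltnW Hi) Sc.
    by rewrite F //; lia.
  + by move=> x Hxx; rewrite F ?F1 //; lia.
  + by right.
- lia.
- lia.
- by move=> h' u' w' t' T' Hi' Hw' HT'; apply: HQ Hi' Hw' _; lia.
Qed.

(* Keep in register 17 the longer of the chains pointed to by 17 and [x]. *)
Definition MAXP (x : nat) : cmd :=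
  Seq (Blk [:: ILoad 14 17; ILoad 15 x; ISub 20 15 14])
      (Ite 20 (Blk [:: IAdd 17 x 0]) (Blk [::])).

Lemma maxp_correct B S n s h i row a v w q p z t d u T x y l1 l2
    (Q : seq nat -> (nat -> nat) -> nat -> Prop) :
  ctx B S n s -> (x = 16 /\ y = q) \/ (x = 18 /\ y = z) -> y <= B ->
  lch s S h p l1 -> lch s S h y l2 -> 6 <= T ->
  (forall v' w' p' d' T' l, lch s S h p' l -> l \in [:: l1; l2] ->
     size l1 <= size l -> size l2 <= size l -> T <= T' + 6 ->
     Q (rg S i row a v' w' q p' z t d' u) h T') ->
  wp B (MAXP x) (rg S i row a v w q p z t d u) h T Q.
Proof.
move=> Hx Hxy HyB L1 L2 HT HQ; have [S1 S2] := ctx_S Hx.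
have HS : 24 <= S by lia.
have Hx24 : x < 24 by case: Hxy => -[-> _].
have Hy rho : rho = rg S i row a (size l1) w q p z t d u -> nth 0 rho x = y.
  by move=> ->; case: Hxy => -[-> ->].
apply: wp_seq; bstart.
apply: blk_load_val; [by []|by []|bs; apply: lch_len L1 => //|bs].
apply: (@blk_load_val _ _ _ (size l2)); [by []|by []| |bs].
  by rewrite Hy //; apply: lch_len L2.
do 2 bstep.
apply: wp_ite => //; [by lia| |]; bs => Hd.
- bstart; apply: blk_add => //.
    by move: HyB; case: Hxy => -[-> ->] /=; rewrite addn0.
  bstep; have -> : nth 0 [:: 0; 1; S; 2 * S; 3 * S; 4 * S; 5 * S; 6 * S; 8 * S; S - 1; 23;
      i; row; a; size l1; size l2; q; p; z; t; size l2 - size l1; u; 0; 0] x + 0 = y.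
    by case: Hxy => -[-> ->]; rewrite addn0.
  by apply: (HQ _ _ _ _ _ l2) => //; rewrite ?inE ?eqxx ?orbT //; lia.
- bstart; bstep.
  by apply: (HQ _ _ _ _ _ l1) => //; rewrite ?inE ?eqxx //; lia.
Qed.

(* Walk up again, updating the best chains of the seen values above [a]. *)
Definition LOOP3 : cmd :=
  Wh 20 (Seq (Blk [:: IAdd 19 3 21; ILoad 17 19]) (Seq (MAXP 16)
        (Seq (Blk [:: IAdd 18 7 21; ILoad 18 18; IAdd 18 18 13]) (Seq (MAXP 18)
        (Blk [:: IStore 19 17; IAdd 16 17 0; IAdd 19 6 21; ILoad 21 19; ISub 20 9 21]))))).

(** Entries below [c] already include the new position, those from [c] on do not yet; [q] is the
    updated best chain below [c]. *)
Definition inv3 s S i h0 h c q : Prop :=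
  [/\ (forall x, x < 2 * S \/ 3 * S <= x -> h x = h0 x),
      c = S - 1 \/ index c s < i, nth 0 s i < c,
      rep s S h i.+1 c q
    & (forall u, u < c -> u = 0 \/ index u s < i.+1 ->
         rep s S h i.+1 u.+1 (h (2 * S + u))) /\
      (forall u, c <= u -> index u s < i -> rep s S h i u.+1 (h (2 * S + u)))].

Lemma lch_bound B S n s h q l i y : ctx B S n s -> i <= n -> chain s i y l ->
  lch s S h q l -> q <= B.
Proof.
move=> Hx Hi; case: l => [|[c b] l] /=; first by move=> _ ->.
move=> /and5P[H1 H2 H3 H4 _] [-> _ _ _ _].
have Hb := ctx_bound Hx Hi H3; have [S1 S2] := ctx_S Hx.
have R1 := nrow_bound Hx Hi; have := @nrow_lt S (index c s) i ltac:(lia); lia.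
Qed.

(** At each seen [c] the two comparisons choose among the three candidates of [is_max_update]; the
    third is the node of the edge between [c] and the new value, supplied by the third hypothesis on
    [h0]. *)
Lemma loop3_correct B S n s i h0 : ctx B S n s -> i < n ->
  up_spec s S i h0 (nth 0 s i).+1 ->
  (forall c, index c s < i -> h0 (6 * S + c) = nrow S (index c s)) ->
  (forall c, index c s < i -> nth 0 s i < c -> node s S h0 c (nth 0 s i)) ->
  forall k h c v w q p z t T (Q : seq nat -> (nat -> nat) -> nat -> Prop),
  inv3 s S i h0 h c q ->
  count (fun x => index x s < i) (iota c (S - 1 - c)) <= k ->
  30 * k < T ->
  (forall h' v' w' q' p' z' t' T', inv3 s S i h0 h' (S - 1) q' ->
     T <= T' + 30 * k + 1 ->
     Q (rg S i.+1 (nrow S i) (nth 0 s i) v' w' q' p' z' t' 0 (S - 1)) h' T') ->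
  wp B LOOP3 (rg S i.+1 (nrow S i) (nth 0 s i) v w q p z t (S - 1 - c) c) h T Q.
Proof.
move=> Hx Hi Hup Hrow Hnode; have [Ha Hia] := ctx_nth Hx Hi.
have Hsz := ctx_size Hx.
set a := nth 0 s i in Hup Hnode Ha Hia *.
have [S1 S2] := ctx_S Hx; have RB := nrow_bound Hx (ltnW Hi); have RG := nrow_ge S i.
elim/ltn_ind=> k IH h c v w q p z t T Q Hinv Hk HT HQ; have [F1 W1 W2 F2 [F3 F4]] := Hinv.
case: (eqVneq c (S - 1)) => [Ec|Nc].
  rewrite Ec subnn in Hinv *; apply: wp_wh_stop => //; first by lia.
  by apply: HQ Hinv _; lia.
have Hc : index c s < i by case: W1 => // E; rewrite E eqxx in Nc.
have Hcn := ctx_bound Hx (ltnW Hi) Hc.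
have [U1 U2 U3] := Hup c W2 Hc.
set c' := h0 _ in U1 U2 U3.
have Hc'S : c' <= S - 1.
  by case: U2 => [->|/(ctx_bound Hx (ltnW Hi))]; lia.
have Hk0 : count (fun x => index x s < i) (iota c' (S - 1 - c')) < k.
  apply: leq_trans Hk.
  have -> : S - 1 - c = 1 + (c' - c.+1) + (S - 1 - c') by lia.
  rewrite -addnA iotaD count_cat iotaD count_cat /= Hc.
  have -> : c + 1 + (c' - c.+1) = c' by lia.
  lia.
have [l1 M1 L1] := F4 c (leqnn c) Hc.
have [l2 M2 L2] := F2.
have [lq Mq Lq0] := Hnode c Hc W2.
have RC := @nrow_lt S (index c s) i Hc.
have Lq : lch s S h (nrow S (index c s) + a) ((c, a) :: lq).
  case: Lq0 => [G1 G2 G3 G4 G5]; have RD := nrow_ge S (index c s).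
  split; rewrite ?F1 //; try (right; lia).
  apply: (lch_frame Hx _ (proj1 Mq) _ G5) => [|y Hy]; first by lia.
  by rewrite F1 //; lia.
apply: wp_wh_go => //; [by lia|by rewrite /=; lia|].
apply: wp_seq; bstart; do 3 bstep.
fold (rg S i.+1 (nrow S i) a v w q (h (2 * S + c)) z (2 * S + c) (S - 1 - c) c).
apply: wp_seq; apply: (maxp_correct Hx _ _ L1 L2); [by left| |by lia|].
  exact: lch_bound Hx Hi (proj1 M2) L2.
move=> v1 w1 p1 d1 T1 l3 L3 In3 Sz31 Sz32 HT1.
apply: wp_seq; bstart; do 2 bstep.
have -> : h (6 * S + c) = nrow S (index c s) by rewrite F1 ?Hrow //; lia.
do 2 bstep; fold (rg S i.+1 (nrow S i) a v1 w1 q p1 (nrow S (index c s) + a) (2 * S + c) d1 c).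
apply: wp_seq; apply: (maxp_correct Hx _ _ L3 Lq); [by right|by lia|by lia|].
move=> v2 w2 p2 d2 T2 l4 L4 In4 Sz41 Sz42 HT2.
have M4 : is_max s i.+1 c.+1 l4.
  apply: (@is_max_update s i c l1 l2 lq l4) => //; rewrite -/a ?Hsz //; last 2 first.
  - exact: leq_trans Sz41.
  - exact: leq_trans Sz41.
  move: In3 In4; rewrite !inE => /orP[]/eqP-> /orP[]/eqP->; by rewrite eqxx ?orbT.
have B2 : p2 <= B := lch_bound Hx Hi (proj1 M4) L4.
bstart; do 2 bstep; rewrite addn0.
set h1 := upd _ _ _.
have F x : x <> 2 * S + c -> h1 x = h x by move=> H; rewrite /h1 upd_ne.
have Fr j y q' : j <= n -> rep s S h j y q' -> rep s S h1 j y q'.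
  by move=> Hj; apply: rep_frame Hx Hj _ => x Hxx; apply: F; lia.
have L4' : lch s S h1 p2 l4.
  by apply: lch_frame Hx Hi (proj1 M4) _ L4 => x Hxx; apply: F; lia.
have E5 : h1 (5 * S + c) = c' by rewrite F ?F1 //; lia.
do 2 bstep; rewrite E5; do 2 bstep; split; first by lia.
apply: (IH k.-1); first by lia.
- split=> //; last first.
  + split.
    * move=> y Hy Sy; case: (eqVneq y c) => [->|Nyc].
        by exists l4 => //; rewrite /h1 upd_eq.
      have Hyc : y < c.
        rewrite ltnNge; apply/negP => Hge.
        have Hge' : c < y < c' by lia.
        have /= Hy' := U3 y Hge'.
        case: Sy => [|Sy]; first by lia.
        have Ey : index y s = i by lia.
        have := @index_nth_eq s i y; rewrite Hsz => /(_ Hi Ey); rewrite -/a; lia.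
      by rewrite F; [apply: Fr => //; apply: F3|lia].
    * move=> y Hy Sy; have Hyn := ctx_bound Hx (ltnW Hi) Sy.
      by rewrite F; [apply: Fr; [lia|apply: F4 => //; lia]|lia].
  + exists l4 => //.
    (* No value strictly between [c] and [c'] occurs up to position [i], so the optimum at [c] is
       also the optimum below [c']. *)
    apply: is_max_unseen_range M4 => // y Hy.
    have /= Hy' := U3 y Hy.
    rewrite ltn_neqAle Hy' andbT; apply/eqP => Ey.
    have := @index_nth_eq s i y; rewrite Hsz => /(_ Hi (esym Ey)); rewrite -/a; lia.
  + by lia.
  + by move=> x Hxx; rewrite F ?F1 //; lia.
- lia.
- lia.
- by move=> h' v' w' q' p' z' t' T' Hi' HT'; apply: HQ Hi' _; lia.
Qed.

(** * One arrival of the sweep *)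

(* Where input or output cell [j + 1] lives while the low registers are in use. *)
Definition vaddr (S j : nat) : nat := if j < 23 then S + j.+1 else j.+1.

(** It is also applied one cell past the input, which holds 0 and thereby ends the main loop. *)
Definition READ : cmd :=
  Seq (Blk [:: ISub 20 11 10])
      (Ite 20 (Blk [:: ILoad 13 11]) (Blk [:: IAdd 19 2 11; ILoad 13 19])).

Lemma read_correct B S n s j row a v w q p z t d u h T x
    (Q : seq nat -> (nat -> nat) -> nat -> Prop) :
  ctx B S n s -> j <= n -> h (vaddr S j) = x -> 5 <= T ->
  (forall t' d' T', T <= T' + 5 ->
     Q (rg S j.+1 row x v w q p z t' d' u) h T') ->
  wp B READ (rg S j.+1 row a v w q p z t d u) h T Q.
Proof.
move=> Hx Hj Hv HT HQ; have [S1 S2] := ctx_S Hx.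
have RB := nrow_bound Hx Hj; have RG := nrow_ge S j.
apply: wp_seq; bstart; do 2 bstep.
apply: wp_ite => //; [by lia| |]; bs => Hd; bstart.
- bstep; bstep; have -> : h j.+1 = x by rewrite -Hv /vaddr ifN //; lia.
  by apply: HQ; lia.
- do 3 bstep; have -> : h (S + j.+1) = x by rewrite -Hv /vaddr ifT //; lia.
  by apply: HQ; lia.
Qed.

(** Nodes are asserted for the edges whose smaller endpoint is still to come, which are those that
    later arrivals look up. The pointer [q] is the best chain overall. *)
Definition inv s S n i h q : Prop :=
  [/\ next_spec s S n i h, prev_spec s S i h,
      (forall u, u = 0 \/ index u s < i -> rep s S h i u.+1 (h (2 * S + u))),
      (forall c, index c s < i -> h (6 * S + c) = nrow S (index c s))
    & [/\ (forall c b, index c s < i -> i <= index b s -> 0 < b < c -> node s S h c b),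
          (forall j, j <= n -> h (vaddr S j) = nth 0 s j)
        & rep s S h i (S - 1) q]].

(* Unlink [a] from the unseen values, and store its best chain and node row. *)
Definition MID : seq instr :=
  [:: IAdd 19 4 13; ILoad 20 19; IAdd 20 20 1; IAdd 19 4 14; ILoad 17 19;
      IAdd 20 20 17; IStore 19 20;
      IAdd 19 3 13; ISub 18 19 1; ILoad 16 18; IStore 19 16;
      IAdd 19 7 13; IStore 19 12;
      IAdd 21 9 0; IAdd 19 5 21; ILoad 15 19; ISub 20 15 13].

Definition INSERT : seq instr :=
  [:: IAdd 19 5 21; IStore 19 13; IAdd 19 5 13; IStore 19 15; ISub 20 9 21].

Definition BODY : cmd :=
  Seq (Blk (IConst 14 0 :: NEXT)) (Seq LOOP1 (Seq (Blk MID) (Seq LOOP2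
  (Seq (Blk INSERT) (Seq LOOP3 (Seq (Blk [:: IAdd 11 11 1; IAdd 12 12 8]) READ)))))).

Lemma node_frame B S n s h h' c b : ctx B S n s -> index c s < n -> b <= n ->
  (forall z, 8 * S <= z < nrow S (index c s).+1 -> h' z = h z) ->
  node s S h c b -> node s S h' c b.
Proof.
move=> Hx Hc Hb Hf [l Hl [G1 G2 G3 G4 G5]]; have [S1 S2] := ctx_S Hx.
have R1 := nrow_lt S (ltnSn (index c s)); have R2 := nrow_ge S (index c s).
exists l => //; split; rewrite ?Hf //; try lia.
by apply: (lch_frame Hx (ltnW Hc) (proj1 Hl) _ G5) => y Hy; apply: Hf; lia.
Qed.

(** Charges the walks over larger seen values to the larger neighbours of the new value: beyond [n]
    nothing is ever seen. *)
Lemma count_seen B S n s i c : ctx B S n s -> i < n -> nth 0 s i < c -> c <= S - 1 ->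
  count (fun x => index x s < i) (iota c (S - 1 - c)) <= ldeg s (nth 0 s i).
Proof.
move=> Hx Hi Hac Hc; have [Ha Hia] := ctx_nth Hx Hi; have E := ctx_size Hx.
have [S1 S2] := ctx_S Hx; rewrite /ldeg Hia E; set a := nth 0 s i in Ha Hac *.
set f := fun x => _.
apply: (@leq_trans (count f (iota a.+1 (S - 1 - a.+1)))).
  have -> : S - 1 - a.+1 = (c - a.+1) + (S - 1 - c) by lia.
  rewrite iotaD count_cat; have -> : a.+1 + (c - a.+1) = c by lia.
  exact: leq_addl.
have -> : S - 1 - a.+1 = (n - a) + (S - 1 - a.+1 - (n - a)) by lia.
rewrite iotaD count_cat [X in _ + X](_ : _ = 0) ?addn0 //.
apply/eqP; rewrite -leqn0 leqNgt -has_count; apply/hasPn => x.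
rewrite mem_iota /f => Hxx; apply/negP => /(ctx_bound Hx (ltnW Hi)); lia.
Qed.

Lemma count_unseen B S n s i w : ctx B S n s -> i < n -> 0 < w <= nth 0 s i ->
  count (fun x => i <= index x s) (iota w (nth 0 s i - w)) <= rdeg s (nth 0 s i).
Proof.
move=> Hx Hi Hw; have [Ha Hia] := ctx_nth Hx Hi; rewrite /rdeg Hia.
set a := nth 0 s i in Ha Hw *.
have -> : a.-1 = (w - 1) + (a - w) by lia.
rewrite iotaD count_cat; have -> : 1 + (w - 1) = w by lia.
exact: leq_addl.
Qed.

Lemma index_new B S n s i u : ctx B S n s -> i < n -> u <> nth 0 s i -> index u s <> i.
Proof.
move=> Hx Hi Hu E; apply: Hu; apply: (index_nth_eq _ E).
by rewrite (ctx_size Hx).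
Qed.

(** A smaller neighbour costs at most 30 steps in [LOOP1], a larger one 30 in each of [LOOP2] and
    [LOOP3]; 50 covers the straight-line parts and the loop exits. *)
Lemma body_correct B S n s i h v w q p z t d u T
    (Q : seq nat -> (nat -> nat) -> nat -> Prop) :
  ctx B S n s -> i < n -> inv s S n i h q ->
  60 * (rdeg s (nth 0 s i) + ldeg s (nth 0 s i)) + 50 <= T ->
  (forall h' v' w' q' p' z' t' d' u' T', inv s S n i.+1 h' q' ->
     T <= T' + (60 * (rdeg s (nth 0 s i) + ldeg s (nth 0 s i)) + 50) ->
     Q (rg S i.+2 (nrow S i.+1) (nth 0 s i.+1) v' w' q' p' z' t' d' u') h' T') ->
  wp B BODY (rg S i.+1 (nrow S i) (nth 0 s i) v w q p z t d u) h T Q.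
Proof.
move=> Hx Hi [N P Bst Rw [Nd Inp Rq]] HT HQ.
have [Ha Hia] := ctx_nth Hx Hi; have Nnew := index_new Hx Hi.
have Hsz := ctx_size Hx; have Un := ctx_uniq Hx.
have [S1 S2] := ctx_S Hx; have RB := nrow_bound Hx (ltnW Hi); have RG := nrow_ge S i.
have RB' := nrow_bound Hx Hi; have RL := nrow_lt S (ltnSn i).
have Seen y : index y s < i -> 0 < y <= n := ctx_bound Hx (ltnW Hi).
(* The value 0 does not occur in [s], so it stays unseen and heads the list of unseen values. *)
have I0 : i <= index 0 s.
  by rewrite leqNgt; apply/negP => /Seen.
set a := nth 0 s i in Ha Hia HT HQ Nnew *.
have [N01 N02 N03] := N 0 isT I0.
apply: wp_seq; bstart; do 2 bstep; rewrite !addn0 in N01 N02 N03; rewrite addn0.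
do 5 bstep; rewrite !addn0.
set w0 := h (3 * S) + 1 in N01 N02 N03 *.
have W0a : w0 <= a.
  by rewrite leqNgt; apply/negP => Hlt; have := N03 a ltac:(lia); rewrite Hia ltnn.
apply: wp_seq.
apply: (@loop1_correct B S n s i q u h Hx Hi N (rdeg s a) h 0 w0).
- split=> //.
  + by split=> //; rewrite ?addn0 //; lia.
  + move=> y [Hy|Hy]; apply: Bst; last by right.
    by case: y Hy => [|y] Hy; [left|right; apply: N03; lia].
  + by move=> b Hb Ub; have := N03 b Hb; lia.
- by apply: (count_unseen Hx Hi); rewrite -/a; lia.
- by lia.
move=> h1 v1 p1 z1 t1 T1 [F1 [_ _ V1 V2 V3] B1 Nd1] HT1.
rewrite -/a in V3 B1 Nd1 *.
have E1a : h1 (3 * S + a) = h (3 * S + a) by apply: F1; lia.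
have E1v : h1 (3 * S + v1) = h (3 * S + v1) by apply: F1; lia.
have [Na1 Na2 Na3] := N a ltac:(lia) ltac:(lia).
have [wa Ewa] : exists wa, wa = h (3 * S + a) + a + 1 by eexists.
rewrite -Ewa in Na1 Na2 Na3.
have [Nv1 Nv2 Nv3] := N v1 V1 V2; rewrite V3 in Nv1 Nv2 Nv3.
apply: wp_seq; rewrite /MID; bstart; do 7 bstep; rewrite E1a E1v.
set hA := upd h1 _ _.
do 2 bstep.
have Eq1 : hA (2 * S + a - 1) = h1 (2 * S + a.-1).
  by rewrite /hA upd_ne; [congr h1; lia|lia].
bstep; rewrite Eq1; set q1 := h1 (2 * S + a.-1).
bstep; set hB := upd hA _ _; do 2 bstep; set h2 := upd hB _ _.
have F2 x : x <> 3 * S + v1 -> x <> 2 * S + a -> x <> 6 * S + a -> h2 x = h1 x.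
  by move=> X1 X2 X3; rewrite /h2 upd_ne // /hB upd_ne // /hA upd_ne.
have E2v : h2 (3 * S + v1) = h (3 * S + a) + 1 + h (3 * S + v1).
  by rewrite /h2 upd_ne /hB ?upd_ne /hA ?upd_eq //; lia.
have E2a : h2 (2 * S + a) = q1 by rewrite /h2 upd_ne /hB ?upd_eq //; lia.
have E2r : h2 (6 * S + a) = nrow S i by rewrite /h2 upd_eq.
clearbody h2; clear hA hB Eq1.
do 5 bstep; rewrite !addn0.
have N' : next_spec s S n i.+1 h2.
  move=> y Hy Uy; have Ny : y <> a by move=> E; rewrite E Hia ltnn in Uy.
  case: (eqVneq y v1) => [->|Nyv].
    (* The two gaps, merged with [a] between them, lead from [v1] to the successor [wa] of [a]. *)
    rewrite E2v; have -> : h (3 * S + a) + 1 + h (3 * S + v1) + v1 + 1 = wa by lia.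
    split=> //.
      by rewrite ltn_neqAle Na2 andbT eq_sym; apply/eqP/Nnew; lia.
    move=> x Hxx; rewrite ltnS; case: (ltngtP x a) => Hxa.
    - by apply/ltnW/Nv3; lia.
    - by apply/ltnW/Na3; lia.
    - by rewrite Hxa Hia.
  have [Y1 Y2 Y3] := N y Hy ltac:(lia).
  rewrite F2; [|lia|lia|lia]; rewrite F1; last by lia.
  set wy := _ + y + 1 in Y1 Y2 Y3 *.
  split=> //; last by move=> x /Y3; lia.
  rewrite ltn_neqAle Y2 andbT eq_sym; apply/eqP/Nnew => Ewy.
  (* If [y] and [v1] both had the successor [a], the smaller of them would skip the larger. *)
  case: (ltngtP y v1) => Hyv; last by rewrite Hyv eqxx in Nyv.
  - by have := Y3 v1 ltac:(lia); lia.
  - by have := Nv3 y ltac:(lia); lia.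
have P2 : prev_spec s S i h2.
  move=> y Hy; have Hyn : y < S by case: Hy => [->|/Seen]; lia.
  rewrite F2; [|lia|lia|lia]; rewrite F1; last by lia.
  exact: P.
have F12 x : 8 * S <= x -> h2 x = h1 x by move=> Hxx; rewrite F2 //; lia.
have F02 x : 8 * S <= x < nrow S i -> h2 x = h x.
  by move=> Hxx; rewrite F12 ?F1 //; lia.
have B2 y : y < a \/ index y s < i -> rep s S h2 i y.+1 (h2 (2 * S + y)).
  move=> Hy; have Hyn : y <= n by case: Hy => [|/Seen]; lia.
  have Nya : y <> a by case: Hy => [Hy|/[swap] -> ]; [lia|rewrite Hia ltnn].
  rewrite F2; [|lia|lia|lia].
  by apply: (rep_frame Hx (ltnW Hi) _ (B1 y Hy)) => x Hxx; rewrite F12 //; lia.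
(* No edge with values up to [a] uses the new position, so the chain copied from [a - 1] is optimal
   at [a]. *)
have R1 : rep s S h2 i.+1 a.+1 q1.
  have [l Hl Ll] : rep s S h2 i a q1.
    have := B1 a.-1 ltac:(left; lia); have -> : a.-1.+1 = a by lia.
    by apply: (rep_frame Hx (ltnW Hi)) => x Hxx; rewrite F12 //; lia.
  by exists l => //; apply: is_max_new; rewrite ?Hsz.
have Nd2 b : 0 < b < a -> i <= index b s -> node s S h2 a b.
  move=> Hb Ub; apply: (node_frame Hx _ _ _ (Nd1 b Hb Ub)); rewrite ?Hia //; first by lia.
  by move=> x Hxx; rewrite F12 //; lia.
apply: wp_seq.
apply: (@loop2_correct B S n s i v1 q1 _ _ h2 Hx Hi P2 (ldeg s a) h2 (S - 1)).
- split=> //; [by left|by rewrite -/a; lia|].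
  by move=> c Hc /Seen; lia.
- by apply: (count_seen Hx Hi); rewrite -/a; lia.
- by lia.
move=> h3 u3 w3 t3 T3 [F3 U1 U2 U3 Up3] Hw3 HT3.
rewrite -/a in U2 Hw3 *.
have [Pu1 Pu2 Pu3] := P2 u3 U1; rewrite -U3 in Pu1 Pu2 Pu3.
have Hu3 : u3 < S by case: U1 => [->|/Seen]; lia.
apply: wp_seq; rewrite /INSERT; bstart; do 4 bstep.
set hA := upd h3 _ _; set h4 := upd hA _ _.
have F4 x : x <> 4 * S + u3 -> x <> 4 * S + a -> h4 x = h3 x.
  by move=> X1 X2; rewrite /h4 upd_ne // /hA upd_ne.
have E4u : h4 (4 * S + u3) = a.
  by rewrite /h4 upd_ne /hA ?upd_eq //; lia.
have E4a : h4 (4 * S + a) = w3 by rewrite /h4 upd_eq.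
clearbody h4; clear hA.
have F24 x : x < 4 * S \/ 6 * S <= x -> h4 x = h2 x.
  by move=> Hxx; rewrite F4 ?F3 //; lia.
do 2 bstep.
have P4 : prev_spec s S i.+1 h4.
  move=> y Hy.
  case: (eqVneq y a) => [->|Nya].
    rewrite E4a; split=> //; first by case: Pu2 => Hw; [left|right; lia].
    move=> x Hxx; have := Pu3 x ltac:(lia); have := Nnew x; lia.
  case: (eqVneq y u3) => [->|Nyu].
    rewrite E4u; split=> //; first by right; rewrite Hia.
    move=> x Hxx; have := Pu3 x ltac:(lia); have := Nnew x; lia.
  have Hy' : y = S - 1 \/ index y s < i.
    by case: Hy => Hy; [left|right; have := Nnew y; lia].
  have Hyn : y < S by case: Hy' => [->|/Seen]; lia.
  rewrite F4; [|lia|lia]; rewrite F3; last by lia.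
  have [Y1 Y2 Y3] := P2 y Hy'.
  split=> //; first by case: Y2 => Hw; [left|right; lia].
  move=> x Hxx; have := Y3 x Hxx.
  (* Only the link from [u3] passed over [a]; a second one would skip a seen value. *)
  suff : x <> a by move=> /Nnew; lia.
  move=> Exa; rewrite Exa in Hxx.
  case: (ltngtP y u3) => Hyu; last by rewrite Hyu eqxx in Nyu.
    have := Pu3 y ltac:(lia).
    by case: Hy'; [move=> E; case: U1; [lia|move/Seen; lia]|lia].
  have := Y3 u3 ltac:(lia); case: U1; [|lia].
  by case: Hy'; [lia|move/Seen; lia].
apply: wp_seq.
apply: (@loop3_correct B S n s i h4 Hx Hi _ _ _ (ldeg s a) h4 u3).
- move=> c Hc Sc; have Hcn := Seen _ Sc.
  have Hcu : u3 <= c.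
    by rewrite leqNgt; apply/negP => Hlt; have := Pu3 c; rewrite -/a in Hc; lia.
  have := Up3 c Hcu Sc; rewrite F4 //; lia.
- move=> c Sc; have Hcn := Seen _ Sc.
  have Nca : c <> a by move=> E; rewrite E Hia ltnn in Sc.
  rewrite F24; last by lia.
  by rewrite F2; [rewrite F1; [apply: Rw|]|..]; lia.
- rewrite -/a => c Sc Hac; apply: (node_frame Hx _ _ _ (Nd c a Sc _ _)); rewrite ?Hia //; try lia.
  move=> x Hxx; have RR := nrow_lt S (ltnSn (index c s)).
  have : nrow S (index c s).+1 <= nrow S i by rewrite /nrow leq_mul2r; lia.
  by move=> RI; rewrite F24 ?F02 //; lia.
- have Fr j y q' : j <= n -> rep s S h2 j y q' -> rep s S h4 j y q'.
    by move=> Hj; apply: (rep_frame Hx Hj) => x Hxx; apply: F24; lia.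
  split=> //.
  (* Nothing seen lies between [a] and [u3], so the chain at [a] is the best one below [u3]. *)
  + have [l Hl Ll] := Fr _ _ _ Hi R1; exists l => //.
    apply: is_max_unseen_range Hl => // y Hy.
    by have := Pu3 y ltac:(lia); have := Nnew y; lia.
  split=> y Hy Sy.
  + have Hyn : y < S by lia.
    rewrite F24; last by lia.
    case: (eqVneq y a) => [->|Nya]; first by rewrite E2a; apply: Fr.
    have Sy' : y = 0 \/ index y s < i.
      by case: Sy => Sy; [left|right; have := Nnew y; lia].
    have Hya : y < a.
      rewrite ltnNge; apply/negP => Hge.
      by case: Sy' => [|Sy']; [lia|have := Pu3 y; lia].
    apply: Fr => //; have [l Hl Ll] := B2 y (or_introl Hya); exists l => //.
    by apply: is_max_new_low; rewrite ?Hsz.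
  + have Hyn := Seen _ Sy.
    by rewrite F24; [apply: (Fr _ _ _ (ltnW Hi)); apply: B2; right|lia].
- by apply: (count_seen Hx Hi); rewrite -/a; lia.
- by lia.
move=> h5 v5 w5 q5 p5 z5 t5 T5 [F5 _ _ Rq5 [B5 _]] HT5.
rewrite -/a.
have En : nrow S i + 8 * S = nrow S i.+1 by rewrite /nrow; nia.
apply: wp_seq; bstart; do 3 bstep; rewrite addn1 En.
have F25 x : 6 * S <= x -> h5 x = h2 x.
  by move=> Hxx; rewrite F5 ?F24 //; lia.
have Inp' j : j <= n -> h5 (vaddr S j) = nth 0 s j.
  move=> Hj; have Hv : vaddr S j < 2 * S by rewrite /vaddr; case: ifP; lia.
  rewrite F5; last by lia.
  rewrite F24; last by lia.
  by rewrite F2; [rewrite F1; [apply: Inp|]|..]; lia.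
fold (rg S i.+2 (nrow S i.+1) a v5 w5 q5 p5 z5 t5 0 (S - 1)).
apply: (read_correct Hx Hi (Inp' _ Hi)); first by lia.
move=> t6 d6 T6 HT6; apply: HQ; last by lia.
split.
- move=> y Hy Uy; rewrite F5; last by lia.
  by rewrite F24; [apply: N'|lia].
- move=> y Hy; have Hyn : y < S.
    by case: Hy => [->|/(ctx_bound Hx Hi)]; lia.
  by rewrite F5; [apply: P4|lia].
- move=> y Hy; apply: B5 => //.
  by case: Hy => [->|/(ctx_bound Hx Hi)]; lia.
- move=> c Sc; have Hcn := ctx_bound Hx Hi Sc.
  rewrite F25; last by lia.
  case: (eqVneq c a) => [->|Nca]; first by rewrite E2r Hia.
  rewrite F2; [|lia|lia|lia]; rewrite F1; last by lia.
  by apply: Rw; have := Nnew c; lia.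
- split=> // c b Sc Ub Hb.
  have Hcn := ctx_bound Hx Hi Sc.
  case: (eqVneq c a) => [Ec|Nca].
    rewrite Ec in Hb *.
    apply: (node_frame Hx _ _ _ (Nd2 b Hb (ltnW Ub))); rewrite ?Hia //; first by lia.
    by move=> x Hxx; rewrite F25 //; lia.
  have Sc' : index c s < i by have := Nnew c; lia.
  apply: (node_frame Hx _ _ _ (Nd c b Sc' (ltnW Ub) Hb)); try lia.
  move=> x Hxx; have : nrow S (index c s).+1 <= nrow S i by rewrite /nrow leq_mul2r; lia.
  by move=> RI; rewrite F25 ?F02 //; lia.
Qed.

(** The constant 52 adds the loop test and the jump back to the fixed cost 50 of the body. *)
Lemma main_loop_correct B S n s : ctx B S n s ->
  forall k i h v w q p z t d u T (Q : seq nat -> (nat -> nat) -> nat -> Prop),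
  i + k = n -> inv s S n i h q ->
  \sum_(a <- drop i s) (60 * (rdeg s a + ldeg s a) + 52) < T ->
  (forall h' i' row' v' w' q' p' z' t' d' u' T', inv s S n n h' q' ->
     T <= T' + (\sum_(a <- drop i s) (60 * (rdeg s a + ldeg s a) + 52)) + 1 ->
     Q (rg S i' row' 0 v' w' q' p' z' t' d' u') h' T') ->
  wp B (Wh 13 BODY) (rg S i.+1 (nrow S i) (nth 0 s i) v w q p z t d u) h T Q.
Proof.
move=> Hx; have E := ctx_size Hx.
elim=> [|k IH] i h v w q p z t d u T Q Hi Hinv HT HQ.
  have En : i = n by lia.
  subst i; rewrite nth_default; last by rewrite E; lia.
  apply: wp_wh_stop => //; first by lia.
  by apply: HQ => //; lia.
have Hin : i < n by lia.
have [Ha _] := ctx_nth Hx Hin.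
rewrite (drop_nth 0) ?E // big_cons in HT HQ.
apply: wp_wh_go => //; [by lia|by rewrite /=; lia|].
apply: (body_correct Hx Hin Hinv); first by lia.
move=> h' v' w' q' p' z' t' d' u' T' Hinv' HT'; split; first by lia.
apply: IH => //; [by lia|by lia|].
move=> h2 i2 row2 v2 w2 q2 p2 z2 t2 d2 u2 T2 Hinv2 HT2.
by apply: HQ => //; lia.
Qed.

(** * Input relocation and output *)

Definition WRITE (x : nat) : cmd :=
  Seq (Blk [:: ISub 20 11 10])
      (Ite 20 (Blk [:: IStore 11 x]) (Blk [:: IAdd 19 2 11; IStore 19 x])).

Lemma write_correct B S n s j row a v w q p z t d u h T x y
    (Q : seq nat -> (nat -> nat) -> nat -> Prop) :
  ctx B S n s -> j <= 2 * n -> (x = 13 /\ y = a) \/ (x = 14 /\ y = v) -> 5 <= T ->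
  (forall t' d' T', T <= T' + 5 ->
     Q (rg S j.+1 row a v w q p z t' d' u) (upd h (vaddr S j) y) T') ->
  wp B (WRITE x) (rg S j.+1 row a v w q p z t d u) h T Q.
Proof.
move=> Hx Hj Hxy HT HQ; have [S1 S2] := ctx_S Hx.
have RB := nrow_bound Hx (leq0n n); have RG := nrow_ge S 0.
have HS : 2 * n < S by case: Hx => _ Hn -> _; lia.
apply: wp_seq; bstart; do 2 bstep.
apply: wp_ite => //; [by lia| |]; bs => Hd; case: Hxy => -[-> Ey]; rewrite -{}Ey in HQ *;
  bstart; rewrite /vaddr in HQ.
- by do 2 bstep; rewrite ifN in HQ; [apply: HQ; lia|lia].
- by do 2 bstep; rewrite ifN in HQ; [apply: HQ; lia|lia].
- by do 3 bstep; rewrite ifT in HQ; [apply: HQ; lia|lia].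
- by do 3 bstep; rewrite ifT in HQ; [apply: HQ; lia|lia].
Qed.

Definition flat (l : seq (nat * nat)) : seq nat := flatten [seq [:: e.1; e.2] | e <- l].

Definition OUTLOOP : cmd :=
  Wh 16 (Seq (Blk [:: IAdd 18 16 2; ILoad 17 18; IAdd 18 18 2; ILoad 13 18;
                      IAdd 18 18 2; ILoad 14 18])
        (Seq (WRITE 13) (Seq (Blk [:: IAdd 11 11 1]) (Seq (WRITE 14)
        (Blk [:: IAdd 11 11 1; IAdd 16 17 0]))))).

Lemma vaddr_inj S j k : j < S - 1 -> k < S - 1 -> j <> k -> vaddr S j <> vaddr S k.
Proof. by rewrite /vaddr; case: ifP; case: ifP; lia. Qed.

(** Output goes to addresses below [2 * S] and avoids [S], where the number of edges is kept; the
    nodes still to be read lie above it, from [8 * S] on. *)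
Lemma out_correct B S n s : ctx B S n s ->
  forall l i y j h row a v w q p z t d u T
    (Q : seq nat -> (nat -> nat) -> nat -> Prop),
  i <= n -> chain s i y l -> lch s S h q l -> j + 2 * size l <= 2 * n ->
  24 * size l < T ->
  (forall h' j' a' v' p' z' t' d' T',
     (forall m, m < j -> h' (vaddr S m) = h (vaddr S m)) ->
     (forall m, m < 2 * size l -> h' (vaddr S (j + m)) = nth 0 (flat l) m) ->
     h' S = h S -> T <= T' + 24 * size l + 1 ->
     Q (rg S j' row a' v' w 0 p' z' t' d' u) h' T') ->
  wp B OUTLOOP (rg S j.+1 row a v w q p z t d u) h T Q.
Proof.
move=> Hx; have [S1 S2] := ctx_S Hx.
have HS : 2 * n < S - 1 by case: Hx => _ Hn -> _; lia.
have RB0 := nrow_bound Hx (leq0n n); have RG0 := nrow_ge S 0.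
elim=> [|[c b] l IH] i y j h row a v w q p z t d u T Q Hi Hc Hl Hj HT HQ.
  move: Hl => /= Eq; rewrite Eq; apply: wp_wh_stop => //.
  by apply: HQ => // ; lia.
move: HT HQ Hj => /= HT HQ Hj.
have Cl := Hc; move: Cl => /= /and5P[H1 H2 H3 H4 H5].
have Hl0 := Hl; move: Hl0 => /= [G1 G2 G3 G4 G5].
have Hb := ctx_bound Hx Hi H3.
have RC := @nrow_lt S (index c s) i ltac:(lia); have RG := nrow_ge S (index c s).
have RB := nrow_bound Hx Hi.
apply: wp_wh_go => //; [by lia|by rewrite /=; lia|].
apply: wp_seq; bstart; do 7 bstep; rewrite G3 G4.
fold (rg S j.+1 row c b w q (h (q + S)) (q + S + S + S) t d u).
apply: wp_seq; apply: (write_correct (y := c) Hx); [lia|by left|lia|].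
move=> t1 d1 T1 HT1; set h1 := upd _ _ _.
apply: wp_seq; bstart; do 2 bstep; rewrite addn1.
fold (rg S j.+2 row c b w q (h (q + S)) (q + S + S + S) t1 d1 u).
apply: wp_seq; apply: (write_correct (y := b) Hx); [lia|by right|lia|].
move=> t2 d2 T2 HT2; set h2 := upd h1 _ _.
have V x : x < S - 1 -> vaddr S x < 2 * S /\ S <> vaddr S x.
  by rewrite /vaddr; case: ifP; lia.
have [Va Va'] := V j ltac:(lia); have [Vb Vb'] := V j.+1 ltac:(lia).
have G5' : lch s S h2 (h (q + S)) l.
  apply: (lch_frame Hx _ H5 _ G5) => [|x Hxx]; first by lia.
  by rewrite /h2 upd_ne /h1 ?upd_ne //; lia.
have Hidx : index c s <= n by lia.
have Bq := lch_bound Hx Hidx H5 G5.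
bstart; do 3 bstep; rewrite addn1 addn0.
fold (rg S j.+3 row c b w (h (q + S)) (h (q + S)) (q + S + S + S) t2 d2 u).
split; first by lia.
apply: (IH _ _ _ _ _ _ _ _ _ _ _ _ _ _ _ _ Hidx H5 G5'); [lia|lia|].
move=> h' j' a' v' p' z' t' d' T' F1 F2 F3 HT'.
apply: HQ; last by lia.
- move=> m Hm; rewrite F1; last by lia.
  by rewrite /h2 upd_ne /h1 ?upd_ne //; apply: vaddr_inj; lia.
- move=> [|[|m]] Hm /=.
  + rewrite addn0 F1; last by lia.
    by rewrite /h2 upd_ne /h1 ?upd_eq //; apply: vaddr_inj; lia.
  + by rewrite addn1 F1 ?/h2 ?upd_eq //; lia.
  + by rewrite -[m.+2]add2n addnA addn2; apply: F2; lia.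
- by rewrite F3 /h2 upd_ne /h1 ?upd_ne.
Qed.

(** Register 0 is the running address and register 1 the constant 1, so saving occupies no further
    register. *)
Fixpoint saves (r k : nat) : seq instr :=
  if k is k'.+1 then [:: IAdd 0 0 1, IStore 0 r & saves r.+1 k'] else [::].

Lemma saves_correct B l Q k : forall r rho h base,
  size rho = 24 -> nth 0 rho 0 = base -> nth 0 rho 1 = 1 -> 2 <= r -> r + k <= 24 ->
  24 <= base -> base + k <= B ->
  (forall rho' h', size rho' = 24 -> nth 0 rho' 0 = base + k ->
     (forall x, 0 < x -> nth 0 rho' x = nth 0 rho x) ->
     (forall j, j < k -> h' (base + j.+1) = nth 0 rho (r + j)) ->
     (forall x, x <= base \/ base + k < x -> h' x = h x) ->
     blk B l rho' h' Q) ->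
  blk B (saves r k ++ l) rho h Q.
Proof.
elim: k => [|k IH] r rho h base Hs H0 H1 Hr Hrk Hb HB HQ.
  by apply: HQ => //; rewrite ?addn0.
rewrite /=; split=> //; first by rewrite H0 H1; lia.
have E0 : nth 0 (set_nth 0 rho 0 (nth 0 rho 0 + nth 0 rho 1)) 0 = base.+1.
  by rewrite nth_set_nth /= H0 H1 addn1.
have Ex x : 0 < x -> nth 0 (set_nth 0 rho 0 (nth 0 rho 0 + nth 0 rho 1)) x = nth 0 rho x.
  by move=> Hx; rewrite nth_set_nth /=; case: eqP => //; lia.
split=> //; rewrite ?E0 //; try lia.
rewrite Ex; last by lia.
apply: (IH _ _ _ base.+1) => //; rewrite ?Ex //; try lia.
  by rewrite size_set_nth Hs.
move=> rho' h' A1 A2 A3 A4 A5; apply: HQ => //.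
- by rewrite A2; lia.
- by move=> x Hx; rewrite A3 ?Ex.
- move=> [|j] Hj; last first.
    by have := A4 j ltac:(lia); rewrite Ex; [rewrite !addSnnS|lia].
  by rewrite A5 ?addn1 ?addn0 ?upd_eq //; lia.
- by move=> x Hx; rewrite A5 ?upd_ne //; lia.
Qed.

(** The order is descending and stops at register 2, because registers 0 and 1 serve as decrement
    and address. *)
Fixpoint loads (k : nat) : seq instr :=
  if k is k'.+1 then [:: ILoad k'.+2 1, ISub 1 1 0 & loads k'] else [::].

Lemma loads_correct B l Q k : forall rho h base,
  size rho = 24 -> nth 0 rho 0 = 1 -> nth 0 rho 1 = base + k.+1 -> k.+1 < 24 ->
  24 <= base ->
  (forall rho', size rho' = 24 -> nth 0 rho' 0 = 1 -> nth 0 rho' 1 = base + 1 ->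
     (forall j, 1 < j <= k.+1 -> nth 0 rho' j = h (base + j)) ->
     (forall j, k.+1 < j -> nth 0 rho' j = nth 0 rho j) ->
     blk B l rho' h Q) ->
  blk B (loads k ++ l) rho h Q.
Proof.
elim: k => [|k IH] rho h base Hs H0 H1 Hk Hb HQ.
  by apply: HQ => //; lia.
rewrite /=; split=> //.
have -> : cell rho h (nth 0 rho 1) = h (base + k.+2).
  by rewrite H1 cell_heap //; lia.
split=> //; set r1 := set_nth 0 rho _ _; set r2 := set_nth 0 r1 _ _.
have E1 x : nth 0 r1 x = if x == k.+2 then h (base + k.+2) else nth 0 rho x.
  by rewrite nth_set_nth.
have E2 x : nth 0 r2 x = if x == 1 then base + k.+1 else nth 0 r1 x.
  by rewrite nth_set_nth /= !E1 /= H0 H1; case: eqP => //; lia.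
have Hs2 : size r2 = 24 by rewrite !size_set_nth Hs; lia.
apply: (IH _ _ base) => //; rewrite ?E2 ?E1 //; try lia.
move=> rho' A1 A2 A3 A4 A5; apply: HQ => //.
- move=> j Hj; case: (leqP j k.+1) => Hjk; first by apply: A4; lia.
  have -> : j = k.+2 by lia.
  by rewrite A5 // E2 /= E1 eqxx.
- move=> j Hj; rewrite A5; last by lia.
  rewrite E2 E1; case: eqP => [|_]; first by lia.
  by case: eqP => //; lia.
Qed.

(* Initially no register at a known address is free. Doubling [R[0] = n] six times
   gives the address [S + 1 = 64 n], which lies above the input and above register
   23, so register 1 can be saved there; the others follow. *)
Definition RELOCATE : seq instr :=
  [:: IAdd 0 0 0, IAdd 0 0 0, IAdd 0 0 0, IAdd 0 0 0, IAdd 0 0 0, IAdd 0 0 0,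
      IStore 0 1, IConst 1 1 & saves 2 22].

(** After the saves register 0 holds [S + 23], from which [S] is recovered. *)
Definition SETUP : seq instr :=
  [:: IConst 10 23; ISub 2 0 10; IConst 0 0; IAdd 3 2 2; IAdd 4 3 2; IAdd 5 4 2;
      IAdd 6 5 2; IAdd 7 6 2; IAdd 8 5 5; ISub 9 2 1; IConst 11 1; IAdd 12 8 0;
      IConst 16 0; IConst 22 0; IConst 23 0].

(* Register 1 is the source address and is loaded last, through itself; the number
   of edges was left at address [S]. *)
Definition RESTORE : seq instr :=
  [:: IAdd 1 2 10; IConst 0 1] ++ loads 22 ++ [:: ISub 0 1 0; ILoad 0 0; ILoad 1 1].

(** The empty permutation is treated apart, since the layout rests on a positive [S]. *)
Definition MATCH : cmd :=
  Ite 0 (Seq (Blk (RELOCATE ++ SETUP)) (Seq READ (Seq (Wh 13 BODY)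
        (Seq (Blk [:: ILoad 14 16; IStore 2 14; IConst 11 1]) (Seq OUTLOOP
        (Blk RESTORE))))))
    (Blk [::]).

Lemma relocate_correct B S n s rho h T (Q : seq nat -> (nat -> nat) -> nat -> Prop) :
  ctx B S n s -> size rho = 24 -> cell rho h =1 regs (init s) -> 67 <= T ->
  (forall h' a v w p z t d u, (forall j, j <= n -> h' (vaddr S j) = nth 0 s j) ->
     (forall x, 2 * S <= x -> h' x = 0) ->
     Q (rg S 1 (nrow S 0) a v w 0 p z t d u) h' (T - 67)) ->
  wp B (Blk (RELOCATE ++ SETUP)) rho h T Q.
Proof.
move=> Hx Hs Hc HT HQ; have Hsz := ctx_size Hx; have [S1 S2] := ctx_S Hx.
have RB := nrow_bound Hx (leq0n n); have RG := nrow_ge S 0.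
have Hn : 0 < n by case: Hx.
have ES : S = 64 * n - 1 by case: Hx.
have Er x : 0 < x < 24 -> nth 0 rho x = nth 0 s x.-1.
  by move=> Hxx; have := Hc x; rewrite /cell /init /= ifT ?ifN //; lia.
have Eh x : 24 <= x -> h x = nth 0 s x.-1.
  by move=> Hxx; have := Hc x; rewrite cell_heap //= ifN //; lia.
have E0 : nth 0 rho 0 = n by have := Hc 0; rewrite /cell /= Hsz.
apply: wp_blk; [by vm_compute; reflexivity|exact: HT|].
case: rho Hs Er {Hc} E0 => [|r0 rho] Hs Er E0; first by discriminate Hs.
rewrite [nth 0 _ 0]/= in E0.
rewrite {}E0 in Er *; rewrite /RELOCATE 8!cat_cons.
have dbl k l r h0 QQ : 0 < k -> k * 2 * n <= B ->
    blk B l [:: k * 2 * n & r] h0 QQ -> blk B (IAdd 0 0 0 :: l) [:: k * n & r] h0 QQ.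
  move=> Hk HB Hl; apply: blk_add => //=; first by lia.
  by have -> : k * n + k * n = k * 2 * n by lia.
have -> : n :: rho = 1 * n :: rho by rewrite mul1n.
do 6 (apply: (dbl _); [by []|by lia|]).
have -> : 1 * 2 * 2 * 2 * 2 * 2 * 2 * n = S + 1 by lia.
case: rho Hs Er => [|r1 rho] Hs Er; first by discriminate Hs.
apply: blk_store; [by []|by []|by rewrite /=; lia|].
apply: blk_const; [by []|by lia|].
rewrite [nth 0 _ 0]/= [nth 0 _ 1]/= [set_nth _ _ _ _]/=.
apply: (saves_correct (base := S + 1)); [by []|by []|by []|by []|by []|by lia|by lia|].
move=> rho' h' Hs' A0 A1 A2 A3.
(* The list is written out entry by entry so that [bstep] can compute with it. *)
have -> : rho' = mkseq (nth 0 rho') 24 by rewrite -Hs' mkseq_nth.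
have A11 := A1 1 isT; rewrite /= in A11.
rewrite /mkseq; cbn [iota map]; rewrite A0 A11.
rewrite /SETUP; do 16 bstep.
have -> : S + 1 + 22 - 23 = S by lia.
have -> : S + S = 2 * S by lia.
have -> : 2 * S + S = 3 * S by lia.
have -> : 3 * S + S = 4 * S by lia.
have -> : 4 * S + S = 5 * S by lia.
have -> : 5 * S + S = 6 * S by lia.
have -> : 4 * S + 4 * S = 8 * S by lia.
rewrite addn0; have E8 : nrow S 0 = 8 * S by rewrite /nrow mul1n.
rewrite E8 in HQ.
apply: HQ => [j Hj|x Hxx]; last first.
  rewrite A3; last by lia.
  rewrite upd_ne; last by lia.
  by rewrite Eh ?nth_default ?Hsz //; lia.
rewrite /vaddr; case: ifP => Hj23; last first.
  rewrite A3; last by lia.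
  by rewrite upd_ne ?Eh //; lia.
case: j Hj Hj23 => [|j] Hj Hj23.
  by rewrite A3 ?upd_eq; [have /= -> := Er 1 isT|lia].
have -> : S + j.+2 = S + 1 + j.+1 by lia.
by rewrite A2; [have /= -> := Er j.+2 ltac:(lia)|lia].
Qed.

(** Zeroed memory is a valid state: zero gaps link all values in order, the sentinel points to the
    end mark 0, and null pointers are empty chains. *)
Lemma inv_start B S n s h : ctx B S n s ->
  (forall j, j <= n -> h (vaddr S j) = nth 0 s j) ->
  (forall x, 2 * S <= x -> h x = 0) -> inv s S n 0 h 0.
Proof.
move=> Hx Hin H0; have [S1 S2] := ctx_S Hx; split=> //.
- by move=> v Hv _; rewrite H0 /=; [split=> //; lia|lia].
- by move=> v [->|//]; rewrite H0 /=; [split=> //; [lia|left]|lia].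
- move=> u [->|//]; rewrite H0; last by lia.
  by exists [::] => //; apply: is_max_nil_pos.
- by split=> //; exists [::] => //; apply: is_max_nil_pos.
Qed.

Lemma restore_correct B S n s i row a v w q p z t d u h T
    (Q : seq nat -> (nat -> nat) -> nat -> Prop) :
  ctx B S n s -> 49 <= T ->
  (forall rho', nth 0 rho' 0 = h S ->
     (forall j, 0 < j < 24 -> nth 0 rho' j = h (S + j)) -> Q rho' h (T - 49)) ->
  wp B (Blk RESTORE) (rg S i row a v w q p z t d u) h T Q.
Proof.
move=> Hx HT HQ; have [S1 S2] := ctx_S Hx.
have RB := nrow_bound Hx (leq0n n); have RG := nrow_ge S 0.
apply: wp_blk; [by vm_compute; reflexivity|exact: HT|].
rewrite /RESTORE /rg; do 2 (rewrite cat_cons; bstep); rewrite cat0s.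
apply: (loads_correct (base := S)) => //; first by lia.
move=> rho' A1 A2 A3 A4 A5.
apply: blk_sub => //; rewrite A2 A3 addnK.
have se r k x : nth 0 (set_nth 0 r k x) k = x by rewrite nth_set_nth /= eqxx.
have s1 r x : nth 0 (set_nth 0 r 0 x) 1 = nth 0 r 1 by rewrite nth_set_nth.
apply: blk_load => //; rewrite se; first by lia.
apply: blk_load => //; rewrite !s1 A3; first by lia.
apply: HQ; first by rewrite !nth_set_nth /=.
move=> [|[|j]] Hj //.
by do 3 rewrite nth_set_nth /=; apply: A4; lia.
Qed.

Lemma nth_flat l : forall i, nth 0 (flat l) i.*2 = (nth (0, 0) l i).1 /\
  nth 0 (flat l) i.*2.+1 = (nth (0, 0) l i).2.
Proof.
by elim: l => [|e l IH] [|i] //=; apply: IH.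
Qed.

Lemma output_chain s x y l st : chain s x y l -> regs st 0 = size l ->
  (forall j, j < 2 * size l -> regs st j.+1 = nth 0 (flat l) j) ->
  output st = map swap l.
Proof.
move=> Hc H0 Hj; rewrite /output H0; apply: (@eq_from_nth _ (0, 0)).
  by rewrite !size_map size_iota.
move=> i; rewrite size_map size_iota => Hi.
rewrite (nth_map 0) ?size_iota // nth_iota // add0n !Hj; [|lia|lia].
have [-> ->] := nth_flat l i; rewrite (nth_map (0, 0)) // /swap.
have [H _ _ _] := chain_mem Hc (mem_nth (0, 0) Hi).
by rewrite (minn_idPr (ltnW H)) (maxn_idPl (ltnW H)).
Qed.

(** The sweep takes 120 steps per edge and 52 per position, the output at most 24 per position, and
    the remaining code a constant number. *)
Lemma match_correct B S n s rho h T : ctx B S n s -> size rho = 24 ->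
  cell rho h =1 regs (init s) -> 200 * (num_edges s + n + 1) <= T ->
  wp B MATCH rho h T (fun rho' h' _ => forall st, regs st =1 cell rho' h' ->
    max_induced_matching s (output st)).
Proof.
move=> Hx Hs Hc HT; have [S1 S2] := ctx_S Hx; have Hsz := ctx_size Hx.
have [Hp Hn _ _] := Hx.
have RB := nrow_bound Hx (leq0n n); have RG := nrow_ge S 0.
have sumE : \sum_(a <- s) (60 * (rdeg s a + ldeg s a) + 52) = 120 * num_edges s + 52 * n.
  rewrite big_split /= -big_distrr /= (sum_deg Hp) big_const_seq count_predT Hsz iter_addn_0.
  lia.
have E0 : nth 0 rho 0 = n by have := Hc 0; rewrite /cell /= Hsz.
apply: wp_ite => //; [by lia|move=> _|by rewrite E0; lia].
apply: wp_seq; apply: (relocate_correct Hx Hs Hc); first by lia.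
move=> h1 a1 v1 w1 p1 z1 t1 d1 u1 Hin Hz.
apply: wp_seq; apply: (read_correct Hx (leq0n n) (Hin 0 (leq0n n))); first by lia.
move=> t2 d2 T2 HT2.
apply: wp_seq; apply: (main_loop_correct Hx (add0n n) (inv_start Hx Hin Hz)).
  by rewrite drop0 sumE; lia.
rewrite drop0 sumE => h3 i3 row3 v3 w3 q3 p3 z3 t3 d3 u3 T3 [_ _ _ _ [_ _ [l Hl Lq]]] HT3.
have Hsl := chain_size (proj1 Hl).
apply: wp_seq; bstart.
apply: (@blk_load_val _ _ _ (size l)) => //.
  by apply: lch_len Lq => //; lia.
bs; do 3 bstep.
set h4 := upd _ _ _.
have L4 : lch s S h4 q3 l.
  apply: (lch_frame Hx (leqnn n) (proj1 Hl) _ Lq) => x Hxx.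
  by rewrite /h4 upd_ne //; lia.
fold (rg S 1 row3 0 (size l) w3 q3 p3 z3 t3 d3 u3).
apply: wp_seq; apply: (out_correct Hx (leqnn n) (proj1 Hl) L4); [lia|lia|].
move=> h5 j5 a5 v5 p5 z5 t5 d5 T5 _ F1 F2 HT5.
apply: (restore_correct Hx); first by lia.
move=> rho' G0 G1 st Hst.
rewrite (@output_chain s n (S - 1) l st (proj1 Hl)).
- by apply: (is_max_matching Hp _ Hl); lia.
- by rewrite Hst /cell /= G0 F2 /h4 upd_eq.
- move=> j Hj; rewrite Hst -F1 // add0n /vaddr /cell ltnS.
  by case: ifP => // Hj23; apply: G1.
Qed.

Theorem theorem2 :
  exists (P : program) (c : nat),
    forall (n : nat) (s : seq nat), perm_eq s (iota 1 n) ->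
      exists T : nat,
        [/\ T <= c * (num_edges s + n + 1),
            halted P (run P T (init s)),
            (forall t r, t <= T -> regs (run P t (init s)) r <= (n + 2) ^ c) &
            max_induced_matching s (output (run P T (init s)))].
Proof.
exists (compile 0 MATCH), 200 => n s Hp.
have Hsz : size s = n by rewrite (perm_size Hp) size_iota.
(* The memory in use is quadratic; its factor [2 ^ 10] is absorbed by ten further powers of [n + 2],
   which is at least 2. *)
have HB : (64 * n - 1) * (8 * n + 24) <= (n + 2) ^ 200.
  apply: (@leq_trans ((n + 2) ^ 12)); last by rewrite leq_pexp2l // addn2.
  apply: (@leq_trans (2 ^ 10 * (n + 2) ^ 2)); first by nia.
  by rewrite (expnD _ 10 2) leq_mul2r leq_exp2r // addn2 orbT.
have Hn2 : n <= (n + 2) ^ 200.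
  apply: (@leq_trans ((n + 2) ^ 1)); first by rewrite expn1 leq_addr.
  by rewrite leq_pexp2l // addn2.
move: ((n + 2) ^ 200) HB Hn2 => B HB Hn2.
pose m := regs (init s).
(* The first 24 cells are copied into the list, while the heap may be the whole memory, as [cell]
   reads it only from 24 on. *)
have Hc : cell (mkseq m 24) m =1 m.
  by move=> r; rewrite /cell; case: ifP => // Hr; rewrite nth_mkseq.
have Hb r : m r <= B.
  rewrite /m /=; case: ifP => _; first by rewrite Hsz.
  case: (ltnP r.-1 n) => Hr; last by rewrite nth_default ?Hsz.
  apply: leq_trans Hn2; have := mem_nth 0 (n := r.-1) (s := s).
  by rewrite Hsz (perm_iota_mem _ Hp) => /(_ Hr) /andP[].
have Hwp : wp B MATCH (mkseq m 24) m (200 * (num_edges s + n + 1))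
    (fun rho' h' _ => forall st, regs st =1 cell rho' h' ->
       max_induced_matching s (output st)).
  case: (posnP n) => [En|Hn]; last first.
    by apply: (@match_correct B (64 * n - 1) n s); rewrite ?size_mkseq.
  have E0 : nth 0 (mkseq m 24) 0 = 0 by rewrite nth_mkseq // /m /= Hsz En.
  apply: wp_ite; [by []|by lia|by rewrite E0|move=> _].
  apply: (@wp_blk _ _ _ _ _ _ 0) => // st Hst.
  have -> : output st = map swap [::].
    by rewrite /output Hst Hc /m /= Hsz En.
  apply: (@is_max_matching 0 s 1) => //; first by move: Hp; rewrite En.
  exact: is_max_nil_pos.
have [|t [m' [rho' [h' [H1 [H2 H2'] H3 H4 H5]]]]] :=
  Hwp (compile 0 MATCH) 0 m _ (size_mkseq _ _) (fsym Hc) Hb; first by [].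
have Ei : init s = State 0 m by [].
exists t; split=> //.
(* The run ends just past the last instruction, where the default of [nth] is [IHalt]. *)
- by rewrite Ei H2 /halted [pc _]/= add0n nth_default.
- by rewrite Ei H2; apply: H5.
Qed.
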